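(* Let $\epsilon$ be a real number with $0 < \epsilon \leq \frac{1}{2}$ and let $p$ be a prime with $p \geq \max\{75^{3/\epsilon}, e^{100}\}$ (i.e. $p^{\epsilon/3} \geq 75$ and $p \geq e^{100}$). Then \[ \#\left\{ q \text{ prime} : p^{\epsilon/3} < q \leq 72\, p^{\frac{1}{2}+\epsilon},\ q \text{ is a cubic residue modulo } p \right\} \;\geq\; \frac{1}{15}\, p^{\epsilon/3}. \]
   Context: A prime $q$ is a cubic residue modulo $p$ if $q \not\equiv 0 \pmod p$ and $q \equiv y^3 \pmod p$ for some integer $y$. *)

(* Defs.v *)
From mathcomp Require Import all_boot.
From Stdlib Require Import Reals.

(* q is a cubic residue modulo p: q not 0 mod p and q = y^3 mod p for some integer y.
   For nonnegative residues, y may be taken as a natural number (y mod p). *)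
Definition cubic_residue (p q : nat) : Prop :=
  q %% p <> 0 /\ exists y : nat, q = y ^ 3 %[mod p].

(* Main.v *)
(* If [p] is 1 modulo 3, write the Jacobi sum of a cubic character modulo [p] as
   [a + 3 M w] with [w] a primitive cube root of unity, and put [L = 2 a - 3 M], so that
   [4 p = L ^ 2 + 27 M ^ 2].  The cubic Gauss sum shows that every prime [q] other than 3
   and [p] dividing
     [S x = (L x (x - 1) + M (x + 1) (2 x - 1) (x - 2)) / 2]
   is a cubic residue modulo [p]: up to a constant factor, [p * S x] is a value of the norm
   form of the cubic subfield of conductor [p], in which such a [q] must split.  If [p] is 2
   modulo 3 all residues are cubes and a linear [S] suffices.

   For [n] the integer part of [p ^ (eps / 3)] and [x] up to about [5 n], [S x] has size
   between [x ^ 2 sqrt p] and [72 n ^ 3 sqrt p].  As in Chebyshev's argument, apart from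
   three exceptional [x] for each prime [q], the [q]-part of the product of the [S x] is at
   most that of [((5 n)!) ^ 3].  Dropping the exceptional [x] of all primes [q <= n], of
   which there are at most [3 n / 2], the product is still so large that many primes
   [q > n] must divide it. *)

Require Import Defs.
From mathcomp Require Import all_boot all_order all_algebra all_fingroup all_solvable all_field.
From mathcomp Require Import ring zify.
Set Implicit Arguments. Unset Strict Implicit. Unset Printing Implicit Defensive.
Import GRing.Theory Num.Theory.

(** * Cubic Gauss and Jacobi sums *)

Local Open Scope ring_scope.

(** The target field is arbitrary because the sums are evaluated twice: in [algC], to find the norm
    of the Jacobi sum, and in characteristic [q], where the Frobenius acts. *)
Definition cubic_char (K : finFieldType) (F : fieldType) (chi : K -> F) : Prop :=
  [/\ chi 0 = 0, {morph chi : x y / x * y}, forall x, x != 0 -> chi x ^+ 3 = 1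
    & exists u, (u != 0) && (chi u != 1)].

Definition additive_char (K : finFieldType) (F : fieldType) (psi : K -> F) : Prop :=
  [/\ psi 0 = 1, {morph psi : x y / x + y >-> x * y} & \sum_x psi x = 0].

Definition gauss_sum (K : finFieldType) (F : fieldType) (psi chi : K -> F) : F :=
  \sum_x chi x * psi x.

Definition jacobi_sum (K : finFieldType) (F : fieldType) (chi : K -> F) : F :=
  \sum_x chi x * chi (1 - x).

Lemma cubic_char_sqr (K : finFieldType) (F : fieldType) (chi : K -> F) :
  cubic_char chi -> cubic_char (fun x => chi x ^+ 2).
Proof.
case=> chi0 chiM chi3 [u /andP[u0 u1]]; split.
- by rewrite chi0 expr0n.
- by move=> x y; rewrite chiM exprMn.
- by move=> x x0; rewrite exprAC chi3 // expr1n.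
exists u; rewrite u0 /=; apply: contra u1 => /eqP e.
by have := chi3 u u0; rewrite exprS e mulr1 => ->.
Qed.

Lemma cubic_char_sum (K : finFieldType) (F : fieldType) (chi : K -> F) :
  cubic_char chi -> \sum_x chi x = 0.
Proof.
case=> chi0 chiM chi3 [u /andP[u0 u1]].
have : \sum_x chi x = chi u * \sum_x chi x.
  rewrite mulr_sumr (reindex_inj (mulfI u0)) /=.
  by apply: eq_bigr => x _; rewrite chiM.
move/eqP; rewrite -subr_eq0 -{1}[\sum_x _]mul1r -mulrBl mulf_eq0 subr_eq0.
by rewrite eq_sym (negPf u1) => /eqP.
Qed.

Lemma cubic_char1 (K : finFieldType) (F : fieldType) (chi : K -> F) :
  cubic_char chi -> chi 1 = 1.
Proof.
case=> chi0 chiM chi3 _; have c3 := chi3 1 (oner_neq0 K).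
have c2 : chi 1 * chi 1 = chi 1 by rewrite -chiM mulr1.
by move: c3; rewrite exprS expr2 !c2.
Qed.

(** Since -1 is its own cube, its character value is 1. *)
Lemma cubic_charN (K : finFieldType) (F : fieldType) (chi : K -> F) x :
  cubic_char chi -> chi (- x) = chi x.
Proof.
move=> chiP; case: (chiP) => chi0 chiM chi3 _.
have N1 : chi (-1) = 1.
  have := chi3 (-1); rewrite oppr_eq0 oner_neq0 => /(_ isT).
  by rewrite exprS expr2 -!chiM mulrNN !mulr1.
by rewrite -mulN1r chiM N1 mul1r.
Qed.

Lemma additive_char_sum (K : finFieldType) (F : fieldType) (psi : K -> F) a :
  additive_char psi -> \sum_x psi (x * a) = if a == 0 then #|K|%:R else 0.
Proof.
case=> psi0 psiD psiS; case: (eqVneq a 0) => [->|a0].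
  by under eq_bigr do rewrite mulr0 psi0; rewrite sumr_const.
by apply/esym; rewrite -[LHS]psiS (reindex_inj (mulIf a0)).
Qed.

(** Substituting [x = y t] turns [chi x * chi y ^ 2] into [chi t]; summing over [y] first then
    leaves only [t = -1]. *)
Lemma gauss_sum_conj (K : finFieldType) (F : fieldType) (psi chi : K -> F) :
  additive_char psi -> cubic_char chi ->
  gauss_sum psi chi * gauss_sum psi (fun x => chi x ^+ 2) = #|K|%:R.
Proof.
move=> psiP chiP; case: (psiP) => psi0 psiD psiS; case: (chiP) => chi0 chiM chi3 _.
rewrite /gauss_sum mulr_sumr.
transitivity (\sum_y \sum_t chi t * psi (y * (t + 1))).
  apply: eq_bigr => y _; rewrite mulr_suml; case: (eqVneq y 0) => [->|y0].
    rewrite chi0 expr0n mul0r.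
    under eq_bigr do rewrite mulr0; rewrite big1 //.
    under eq_bigr do rewrite mul0r psi0 mulr1.
    by rewrite (cubic_char_sum chiP).
  rewrite (reindex_inj (mulfI y0)); apply: eq_bigr => t _.
  rewrite mulrDr mulr1 psiD chiM.
  transitivity (chi y ^+ 3 * (chi t * (psi (y * t) * psi y))); first by ring.
  by rewrite chi3 // mul1r.
rewrite exchange_big /=.
under eq_bigr do rewrite -mulr_sumr additive_char_sum // addr_eq0.
rewrite (bigD1 (-1)) //= eqxx big1 ?addr0; last first.
  by move=> t /negPf ->; rewrite mulr0.
by rewrite cubic_charN // cubic_char1 // mul1r.
Qed.

(** The terms of the double sum are collected by [s = x + y]. For [s != 0], scaling [x] by [s]
    extracts [chi s ^ 2] and leaves the Jacobi sum; for [s = 0] the sum of [chi ^ 2] vanishes. *)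
Lemma gauss_sum_sqr (K : finFieldType) (F : fieldType) (psi chi : K -> F) :
  additive_char psi -> cubic_char chi ->
  gauss_sum psi chi ^+ 2 = jacobi_sum chi * gauss_sum psi (fun x => chi x ^+ 2).
Proof.
move=> psiP chiP; case: (psiP) => psi0 psiD psiS; case: (chiP) => chi0 chiM chi3 _.
rewrite expr2 {1}/gauss_sum mulr_suml.
transitivity (\sum_x \sum_s chi x * chi (s - x) * psi s).
  apply: eq_bigr => x _; rewrite /gauss_sum mulr_sumr [RHS](reindex_inj (addIr x)).
  by apply: eq_bigr => y _; rewrite addrK psiD; ring.
rewrite exchange_big /= /gauss_sum mulr_sumr; apply: eq_bigr => s _.
rewrite -mulr_suml mulrA; congr (_ * _).
case: (eqVneq s 0) => [->|s0].
  rewrite chi0 expr0n mulr0.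
  under eq_bigr do rewrite sub0r cubic_charN // -expr2.
  exact: cubic_char_sum (cubic_char_sqr chiP).
rewrite (reindex_inj (mulfI s0)) /jacobi_sum mulr_suml; apply: eq_bigr => x _.
have -> : s - s * x = s * (1 - x) by rewrite mulrBr mulr1.
by rewrite !chiM; ring.
Qed.

(** * Discrete logarithms modulo 3 and the coefficients of the Jacobi sum *)

Lemma finField_prim_root (K : finFieldType) :
  exists z : K, (#|K|.-1).-primitive_root z.
Proof.
have K0 : (0 < #|K|.-1)%N by rewrite -subn1 subn_gt0 finNzRing_gt1.
have K1 : (0 < #|K|)%N by rewrite ltnW // finNzRing_gt1.
have : has (#|K|.-1).-primitive_root (enum (predC1 (0 : K))).
  apply: has_prim_root => //.
  - apply/allP => x; rewrite mem_enum inE => x0; apply/unity_rootP.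
    apply: (mulfI x0); by rewrite mulr1 -exprS prednK // expf_card.
  - exact: enum_uniq.
  - by rewrite -cardE cardC1.
by case/hasP => z _ zP; exists z.
Qed.

(** A discrete logarithm that matters only modulo 3; having values in [nat], it yields a cubic
    character in every field containing a primitive cube root of unity. *)
Definition cubic_index (K : finFieldType) (e : K -> nat) : Prop :=
  [/\ forall x y, x != 0 -> y != 0 -> (e (x * y)%R = e x + e y %[mod 3])%N,
      exists u, (u != 0) && (e u %% 3 == 1)%N
    & forall x, x != 0 -> (e x %% 3)%N = 0%N -> exists y, x = y ^+ 3].

Lemma exists_cubic_index (K : finFieldType) :
  (3 %| #|K|.-1)%N -> exists e : K -> nat, cubic_index e.
Proof.
move=> d3; have [z zP] := finField_prim_root K; set n := #|K|.-1 in d3 zP.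
have n0 : (0 < n)%N by rewrite /n -subn1 subn_gt0 finNzRing_gt1.
pose e x := if [pick i : 'I_n | x == z ^+ i] is Some i then nat_of_ord i else 0%N.
have eP x : x != 0 -> x = z ^+ e x.
  move=> x0; rewrite /e; case: pickP => [i /eqP //|no].
  have [|i xi] := prim_rootP zP (x := x); last by have := no i; rewrite xi eqxx.
  apply: (mulfI x0); rewrite mulr1 -exprS prednK ?expf_card //.
  by rewrite ltnW // finNzRing_gt1.
have z0 i : z ^+ i != 0 by rewrite expf_eq0 (prim_root_eq0 zP) (gtn_eqF n0) andbF.
have eM i j : z ^+ i = z ^+ j -> (i = j %[mod 3])%N.
  move/eqP; rewrite (eq_prim_root_expr zP) => /eqP ij.
  by rewrite -(modn_dvdm i d3) -(modn_dvdm j d3) ij.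
exists e; split.
- move=> x y x0 y0; apply: eM.
  by rewrite exprD -!eP // mulf_neq0.
- exists z; have := z0 1%N; rewrite expr1 => z1; rewrite z1 /=.
  by have /eM -> : z ^+ e z = z ^+ 1 by rewrite expr1 -eP.
move=> x x0 ex; exists (z ^+ (e x %/ 3)).
by rewrite -exprM {1}(eP x x0) {1}(divn_eq (e x) 3) ex addn0.
Qed.

(** These are the coefficients of the Jacobi sum on [1], [w], [w ^ 2]. Being natural numbers, they
    carry identities proved in [algC] over to characteristic [q]. *)
Definition jacobi_count (K : finFieldType) (e : K -> nat) (k : nat) : nat :=
  #|[pred t : K | [&& t != 0, t != 1 & ((e t + e (1 - t)%R) %% 3 == k)%N]]|.

Definition index_char (K : finFieldType) (F : fieldType) (e : K -> nat) (w : F) (x : K) : F :=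
  if x == 0 then 0 else w ^+ e x.

Lemma prim3_root_sum (F : fieldType) (w : F) : 3.-primitive_root w -> w ^+ 2 + w + 1 = 0.
Proof.
move=> wP; have w1 : w - 1 != 0.
  have := eq_prim_root_expr wP 1 0; rewrite expr1 expr0 subr_eq0 => -> //.
apply: (mulfI w1); rewrite mulr0; have w3 := prim_expr_order wP.
by transitivity (w ^+ 3 - 1); [ring | rewrite w3 subrr].
Qed.

Lemma index_char_cubic (K : finFieldType) (F : fieldType) (e : K -> nat) (w : F) :
  cubic_index e -> 3.-primitive_root w -> cubic_char (index_char e w).
Proof.
case=> eM [u /andP[u0 /eqP eu]] _ wP; split.
- by rewrite /index_char eqxx.
- move=> x y; rewrite /index_char mulf_eq0.
  have [->|x0] := eqVneq x 0; first by rewrite /= mul0r.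
  have [->|y0] := eqVneq y 0; first by rewrite /= mulr0.
  by rewrite /= -exprD -(prim_expr_mod wP) eM // (prim_expr_mod wP).
- move=> x /negPf x0; rewrite /index_char x0 -exprM mulnC exprM.
  by rewrite (prim_expr_order wP) expr1n.
exists u; rewrite u0 /index_char (negPf u0) -(prim_expr_mod wP) eu.
by have := eq_prim_root_expr wP 1 0; rewrite expr1 expr0 => ->.
Qed.

Lemma jacobi_sum_index (K : finFieldType) (F : fieldType) (e : K -> nat) (w : F) :
  3.-primitive_root w ->
  jacobi_sum (index_char e w) =
  (jacobi_count e 0)%:R + (jacobi_count e 1)%:R * w + (jacobi_count e 2)%:R * w ^+ 2.
Proof.
move=> wP; have NE k x : (jacobi_count e k)%:R * x =
    \sum_(t : K) if [&& t != 0, t != 1 & ((e t + e (1 - t)%R) %% 3 == k)%N]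
      then x else 0 :> F.
  by rewrite -big_mkcond /= sumr_const mulr_natl.
rewrite -[(jacobi_count e 0)%:R]mulr1 !NE /jacobi_sum -!big_split.
apply: eq_bigr => t _; rewrite /= /index_char.
rewrite subr_eq0 [1 == t]eq_sym.
have [->|t0] := eqVneq t 0; first by rewrite /= mul0r !addr0.
have [->|t1] := eqVneq t 1; first by rewrite /= mulr0 !addr0.
rewrite /= -exprD -(prim_expr_mod wP).
have : ((e t + e (1 - t)%R) %% 3 < 3)%N by rewrite ltn_mod.
by case: (_ %% 3)%N => [|[|[|]]] //= _; rewrite ?expr0 ?expr1 ?mul1r ?addr0 ?add0r.
Qed.

(* The map [t |-> 1 / (1 - t)] has order 3 and preserves the class of [e t + e (1 - t)];
   at a fixed point [t (1 - t) = 1], so this class is 0. *)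
Lemma dvdn_jacobi_count (K : finFieldType) (e : K -> nat) k :
  cubic_index e -> (0 < k < 3)%N -> (3 %| jacobi_count e k)%N.
Proof.
move=> [eM _ _] k12; pose f (t : K) := (1 - t)^-1.
have f_inj : injective f by move=> x y /invr_inj /addrI /oppr_inj.
have e1 : (e 1%R %% 3 = 0)%N.
  have := eM 1 1 (oner_neq0 _) (oner_neq0 _); rewrite mulr1; lia.
have eV x : x != 0 -> (e x + e x^-1%R = 0 %[mod 3])%N.
  by move=> x0; rewrite -eM ?invr_eq0 // divff.
pose a : {pred K} := [pred t | [&& t != 0, t != 1 & ((e t + e (1 - t)%R) %% 3 == k)%N]].
have f1 t : t != 1 -> 1 - f t = - t * f t.
  move=> t1; have t1' : 1 - t != 0 by rewrite subr_eq0 eq_sym.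
  by apply: (mulIf t1'); rewrite /f mulrBl mulfVK // mulVf //; ring.
have fffK t : t != 0 -> t != 1 -> f (f (f t)) = t.
  move=> t0 t1; have t1' : 1 - t != 0 by rewrite subr_eq0 eq_sym.
  have fft : f (f t) = (t - 1) / t.
    by rewrite {1}/f f1 // /f invfM invrK invrN mulNr -mulrN opprB mulrC.
  by rewrite {1}/f fft mulrBl divff // mul1r opprB addrC subrK invrK.
have eN1 : (e (-1)%R %% 3 = 0)%N.
  have := eM (-1) (-1); rewrite mulrNN mulr1 oppr_eq0 oner_neq0 => /(_ isT isT).
  lia.
have fa t : t \in a -> f t \in a.
  rewrite !inE => /and3P[t0 t1 /eqP et].
  have t1' : 1 - t != 0 by rewrite subr_eq0 eq_sym.
  have ft0 : f t != 0 by rewrite invr_eq0.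
  rewrite ft0 eq_sym -subr_eq0 f1 // mulf_neq0 ?oppr_eq0 //=.
  have E1 := eM (- t) (f t); rewrite oppr_eq0 in E1; have {}E1 := E1 t0 ft0.
  have E2 := eM (-1) t; rewrite oppr_eq0 oner_neq0 mulN1r in E2; have {}E2 := E2 isT t0.
  have E3 := eV _ t1'; rewrite -/(f t) in E3.
  apply/eqP; move: E1 E2 E3 eN1 et.
  move: (e _) (e _) (e _) (e _) (e _) (e _) => ? ? ? ? ? ?; lia.
have fixa t : t \in a -> f t != t.
  rewrite inE => /and3P[t0 t1 /eqP et]; apply/eqP => ft.
  have t1' : 1 - t != 0 by rewrite subr_eq0 eq_sym.
  have := eV _ t1'; rewrite -/(f t) ft; lia.
have af t : t \in a -> fcycle f [:: t; f t; f (f t)].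
  by rewrite inE => /and3P[t0 t1 _]; rewrite /= fffK // !eqxx.
(* All orbits of [f] in [a] have length 3, so the cardinal is 3 times the number of orbits. *)
change (3 %| #|a|)%N; rewrite -(@fcard_order_set _ f f_inj 3 a) ?dvdn_mull //.
  apply/subsetP => t ta; rewrite inE.
  rewrite (order_cycle (af t ta)) ?mem_head //= !inE !negb_or !andbT.
  rewrite eq_sym fixa //= [f t == _]eq_sym (fixa _ (fa t ta)) andbT.
  apply: contra (fixa t ta) => /eqP tff.
  by rewrite {1}tff; case/and3P: (ta) => t0 t1 _; rewrite fffK.
move=> x y /eqP <-; apply/idP/idP => [|fx]; first exact: fa.
case: (eqVneq x 0) => [x0|x0].
  by move: fx; rewrite !inE x0 /f subr0 invr1 eqxx andbF.
(* By the convention [0^-1 = 0], [f] sends 1 to 0, which is outside [a]. *)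
case: (eqVneq x 1) => [x1|x1].
  by move: fx; rewrite !inE x1 /f subrr invr0 eqxx.
rewrite -(fffK x) //; exact: fa (fa _ fx).
Qed.

(** As [n] is invertible in [F], [X ^ n - 1] is separable and has [n] distinct roots, one of which
    must be primitive. *)
Lemma closed_prim_root_exists (F : closedFieldType) n :
  n%:R != 0 :> F -> exists z : F, n.-primitive_root z.
Proof.
move=> n0; have n_gt0 : (0 < n)%N by case: n n0 => //; rewrite eqxx.
have [rs Drs] := closed_field_poly_normal ('X^n - 1 : {poly F}).
move: Drs; rewrite lead_coefDl ?size_polyXn ?size_polyN ?size_poly1 //.
rewrite lead_coefXn scale1r => Drs.
have Urs : uniq rs by rewrite -separable_prod_XsubC -Drs separable_Xn_sub_1.
have : has n.-primitive_root rs.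
  apply: has_prim_root => //.
    by apply/allP => x; rewrite -root_prod_XsubC -Drs.
  by rewrite -ltnS -(size_prod_XsubC rs id) -Drs size_XnsubC.
by case/hasP => z _ zP; exists z.
Qed.

Lemma additive_char_prim_root p (F : fieldType) (z : F) :
  prime p -> p.-primitive_root z ->
  additive_char (fun x : 'F_p => z ^+ (x : nat)).
Proof.
move=> pp zP.
have psiD (x y : 'F_p) : z ^+ (x + y : 'F_p)%R = z ^+ x * z ^+ y.
  rewrite -exprD /= -[RHS](prim_expr_mod zP); congr (z ^+ _).
  by rewrite [X in (_ %% X)%N = _]Fp_cast.
split=> //.
have : \sum_(x : 'F_p) z ^+ x = z * \sum_(x : 'F_p) z ^+ x.
  rewrite mulr_sumr (reindex_inj (addrI (1 : 'F_p))).
  by apply: eq_bigr => x _; rewrite psiD.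
move/eqP; rewrite -subr_eq0 -{1}[\sum_x _]mul1r -mulrBl mulf_eq0 subr_eq0.
case/orP => [|/eqP //]; have := eq_prim_root_expr zP 0 1; rewrite expr0 expr1 => ->.
by rewrite mod0n modn_small ?prime_gt1.
Qed.

Lemma index_char_sqr (K : finFieldType) (F : fieldType) (e : K -> nat) (w : F) x :
  index_char e (w ^+ 2) x = index_char e w x ^+ 2.
Proof. by rewrite /index_char; case: eqP => _; rewrite ?expr0n // exprAC. Qed.

Lemma jacobi_sum_sqr (K : finFieldType) (F : fieldType) (e : K -> nat) (w : F) :
  jacobi_sum (fun x => index_char e w x ^+ 2) = jacobi_sum (index_char e (w ^+ 2)).
Proof. by apply: eq_bigr => x _; rewrite !index_char_sqr. Qed.

Lemma cubic_char_exp4 (K : finFieldType) (F : fieldType) (chi : K -> F) x :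
  cubic_char chi -> (chi x ^+ 2) ^+ 2 = chi x.
Proof.
case=> chi0 _ chi3 _; case: (eqVneq x 0) => [->|x0]; first by rewrite chi0 !expr0n.
by rewrite -exprM (exprD _ 3 1) chi3 // mul1r.
Qed.

Lemma gauss_sum_sqr_conj (K : finFieldType) (F : fieldType) (psi chi : K -> F) :
  additive_char psi -> cubic_char chi ->
  gauss_sum psi (fun x => chi x ^+ 2) ^+ 2 =
  jacobi_sum (fun x => chi x ^+ 2) * gauss_sum psi chi.
Proof.
move=> psiP chiP; rewrite (gauss_sum_sqr psiP (cubic_char_sqr chiP)).
by congr (_ * _); apply: eq_bigr => x _; rewrite cubic_char_exp4.
Qed.

(** Multiplying the two formulas for squares of Gauss sums gives [(g g') ^ 2 = J J' g g'], and
    [g g'] is the nonzero [#|K|]. *)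
Lemma jacobi_sum_norm (K : finFieldType) (F : fieldType) (psi chi : K -> F) :
  additive_char psi -> cubic_char chi -> #|K|%:R != 0 :> F ->
  jacobi_sum chi * jacobi_sum (fun x => chi x ^+ 2) = #|K|%:R.
Proof.
move=> psiP chiP n0; apply: (mulIf n0).
have gg := gauss_sum_conj psiP chiP.
rewrite -{1}gg -[in RHS]gg.
have E1 := gauss_sum_sqr psiP chiP; have E2 := gauss_sum_sqr_conj psiP chiP.
set g := gauss_sum psi chi in gg E1 E2 *; set g' := gauss_sum psi _ in gg E1 E2 *.
transitivity (g ^+ 2 * g' ^+ 2); first by rewrite E1 E2; ring.
by ring.
Qed.

(** Eliminating [w ^ 2 = - w - 1] writes the Jacobi sum as [a + b w]; the left side is the norm of
    this number, computed in [algC]. *)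
Lemma jacobi_count_norm p (e : 'F_p -> nat) (a b : int) :
  prime p -> cubic_index e ->
  a = (jacobi_count e 0)%:Z - (jacobi_count e 2)%:Z ->
  b = (jacobi_count e 1)%:Z - (jacobi_count e 2)%:Z ->
  a ^+ 2 - a * b + b ^+ 2 = p%:Z.
Proof.
move=> pp eP Da Db.
have [z zP] := C_prim_root_exists (prime_gt0 pp).
have [w wP] := C_prim_root_exists (isT : (0 < 3)%N).
have w2P : 3.-primitive_root (w ^+ 2) by rewrite prim_root_exp_coprime.
have psiP := additive_char_prim_root pp zP.
have chiP := index_char_cubic eP wP.
have := jacobi_sum_norm psiP chiP; rewrite card_Fp // pnatr_eq0 -lt0n prime_gt0 // => /(_ isT).
rewrite jacobi_sum_sqr !jacobi_sum_index // => E.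
apply: (@intr_inj algC); rewrite !(rmorphD, rmorphB, rmorphM, rmorphXn) /=.
rewrite -[(p%:Z)%:~R]E Da Db !rmorphB /=.
have Dw : w ^+ 2 = - w - 1 by apply/eqP; rewrite -subr_eq0 -(prim3_root_sum wP); apply/eqP; ring.
rewrite -![in RHS](exprAC w) !Dw -!pmulrn; ring: Dw.
Qed.

Lemma gauss_sum_scale (K : finFieldType) (F : fieldType) (psi chi : K -> F) c :
  {morph chi : x y / x * y} -> c != 0 ->
  chi c * \sum_x chi x * psi (x * c) = gauss_sum psi chi.
Proof.
move=> chiM c0; rewrite mulr_sumr /gauss_sum [RHS](reindex_inj (mulIf c0)).
by apply: eq_bigr => x _; rewrite chiM; ring.
Qed.

Lemma sum_exp_pchar (F : fieldType) q (I : finType) (f : I -> F) :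
  q \in [pchar F] -> (\sum_i f i) ^+ q = \sum_i f i ^+ q.
Proof.
move=> qF; rewrite -(pFrobenius_autE qF) rmorph_sum /=.
by apply: eq_bigr => i _; rewrite pFrobenius_autE.
Qed.

(* By hypothesis [u = al g / (be g')] is a cube root of unity.  If [q] is 1 modulo 3, the
   Frobenius [x |-> x ^ q] fixes [u] but maps the quotient to [chi q * u]; if [q] is 2
   modulo 3, it inverts [u] but maps the quotient to [(chi q * u)^-1]. *)
Lemma frobenius_cubic_char p q (F : fieldType) (e : 'F_p -> nat) (w z : F) (x : int) :
  prime p -> prime q -> q != p -> q != 3 -> q \in [pchar F] ->
  cubic_index e -> 3.-primitive_root w -> p.-primitive_root z ->
  (x%:~R + w) ^+ 3 * jacobi_sum (index_char e w) =
  (x%:~R + w ^+ 2) ^+ 3 * jacobi_sum (index_char e (w ^+ 2)) ->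
  index_char e w (q%:R : 'F_p) = 1.
Proof.
move=> pp pq qp q3 qF eP wP zP H.
have psiP := additive_char_prim_root pp zP.
have chiP := index_char_cubic eP wP.
have chi2P := cubic_char_sqr chiP.
have p0 : #|{: 'F_p}|%:R != 0 :> F.
  by rewrite card_Fp // -(dvdn_pcharf qF) dvdn_prime2.
have w0 : w != 0 by rewrite (prim_root_eq0 wP).
have w3 := prim_expr_order wP.
have ww2 : w ^+ 2 != w.
  by have := eq_prim_root_expr wP 2 1; rewrite expr1 => ->.
set psi := (fun x : 'F_p => z ^+ (x : nat)) in psiP.
set chi := index_char e w in chiP chi2P H *.
have gg := gauss_sum_conj psiP chiP.
have E1 := gauss_sum_sqr psiP chiP; have E2 := gauss_sum_sqr_conj psiP chiP.
have JJ := jacobi_sum_norm psiP chiP p0.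
rewrite -jacobi_sum_sqr -/chi in H.
set J := jacobi_sum chi in H E1 JJ; set J' := jacobi_sum _ in H E2 JJ.
have gE : gauss_sum psi chi = \sum_t chi t * psi t by [].
have g'E : gauss_sum psi (fun x => chi x ^+ 2) = \sum_t chi t ^+ 2 * psi t by [].
have c0 : (q%:R : 'F_p) != 0.
  by rewrite -(dvdn_pcharf (pchar_Fp pp)) dvdn_prime2 // eq_sym.
case: (chiP) => chi0 chiM chi3 _; case: (chi2P) => _ chi2M _ _.
have S1 := gauss_sum_scale psi chiM c0; have S2 := gauss_sum_scale psi chi2M c0.
set g := gauss_sum psi chi in gg E1 E2 gE S1; set g' := gauss_sum psi _ in gg E1 E2 g'E S2.
set c := (q%:R : 'F_p) in c0 S1 S2 *.
set al := _ + w in H; set be := _ + w ^+ 2 in H.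
have g0 : g != 0 by apply: contraNneq p0 => g0; rewrite -gg g0 mul0r.
have g'0 : g' != 0 by apply: contraNneq p0 => g0'; rewrite -gg g0' mulr0.
have J0 : J != 0 by apply: contraNneq p0 => J0; rewrite -JJ J0 mul0r.
have J'0 : J' != 0 by apply: contraNneq p0 => J0'; rewrite -JJ J0' mulr0.
have ab : (al == 0) = (be == 0).
  have := congr1 (fun y => y == 0) H; rewrite /= (mulf_eq0 (al ^+ 3)) (mulf_eq0 (be ^+ 3)) !expf_eq0 /=.
  by rewrite (negPf J0) (negPf J'0) !orbF.
(* [al] and [be] vanish together, and their difference is [w - w ^ 2], which is nonzero. *)
have be0 : be != 0.
  apply/negP => be0; have al0 : al == 0 by rewrite ab.
  move/negP: ww2; apply; rewrite -subr_eq0.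
  have -> : w ^+ 2 - w = be - al by rewrite /al /be; ring.
  by rewrite (eqP al0) (eqP be0) subrr.
(* The square formulas give [g ^ 3 = J g g'] and [g' ^ 3 = J' g g'], so [H] says that [al * g] and
   [be * g'] have the same cube. *)
have [i Di] : exists i : nat, al * g = w ^+ i * (be * g').
  have /(prim_rootP wP)[i Di] : (al * g / (be * g')) ^+ 3 = 1.
    rewrite expr_div_n; apply/eqP; rewrite -subr_eq0 -[X in _ - X](divff (_ : (be * g') ^+ 3 != 0)).
      by rewrite -mulrBl mulf_eq0 subr_eq0; apply/orP; left; apply/eqP; ring: H E1 E2.
    by rewrite expf_neq0 // mulf_neq0.
  by exists i; rewrite -Di mulfVK // mulf_neq0.
have psiq t : psi t ^+ q = psi (t * c).
  rewrite /psi /c -exprM -[LHS](prim_expr_mod zP) -[RHS](prim_expr_mod zP).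
  congr (z ^+ _).
  have -> : nat_of_ord (t * c) = ((t * c)%N %% p)%N by rewrite /= [X in (_ %% X)%N = _]Fp_cast.
  by rewrite val_Fp_nat // modn_mod modnMmr.
have intq : (x%:~R : F) ^+ q = x%:~R by rewrite -(pFrobenius_autE qF) rmorph_int.
have addq (u v : F) : (u + v) ^+ q = u ^+ q + v ^+ q.
  by rewrite -!(pFrobenius_autE qF) rmorphD.
have wq : w ^+ q = w ^+ (q %% 3) by rewrite (prim_expr_mod wP).
have q30 : (q %% 3 != 0)%N.
  by apply/negP => d3; move/negP: q3; apply; rewrite eq_sym -dvdn_prime2.
have chiq t : chi t ^+ q = chi t ^+ (q %% 3).
  have [->|t0] := eqVneq t 0; first by rewrite chi0 !expr0n (negPf q30) gtn_eqF // prime_gt0.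
  by rewrite {1}(divn_eq q 3) exprD mulnC exprM chi3 // expr1n mul1r.
have gq : g ^+ q = \sum_t chi t ^+ q * psi (t * c).
  by rewrite gE sum_exp_pchar //; apply: eq_bigr => t _; rewrite exprMn psiq.
have g'q : g' ^+ q = \sum_t (chi t ^+ q) ^+ 2 * psi (t * c).
  by rewrite g'E sum_exp_pchar //; apply: eq_bigr => t _; rewrite exprMn psiq exprAC.
have chic3 := chi3 c c0.
have := congr1 (fun y => y ^+ q) Di; rewrite /= !exprMn -exprM mulnC exprM wq.
have : (q %% 3 < 3)%N by rewrite ltn_mod.
case Dr: (q %% 3)%N q30 chiq => [|[|[|]]] // _ chiq _.
- have Aq : al ^+ q = al by rewrite /al addq intq wq Dr.
  have Bq : be ^+ q = be by rewrite /be addq intq exprAC wq Dr.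
  have Gq : chi c * g ^+ q = g.
    by rewrite gq -[RHS]S1; under eq_bigr do rewrite chiq expr1.
  have G'q : chi c ^+ 2 * g' ^+ q = g'.
    by rewrite g'q -[RHS]S2; under eq_bigr do rewrite chiq expr1.
  rewrite Aq Bq expr1 => E.
  have /(mulIf (_ : al * g != 0)) : chi c * (al * g) = 1 * (al * g).
    rewrite mul1r {2}Di -G'q.
    transitivity (chi c ^+ 2 * (al * g ^+ q)); first by rewrite -{1}Gq; ring.
    by rewrite E; ring.
  by apply; rewrite mulf_neq0 // ab.
have Aq : al ^+ q = be by rewrite /al addq intq wq Dr.
have Bq : be ^+ q = al by rewrite /be addq intq exprAC wq Dr -exprM (exprD _ 3 1) w3 mul1r.
have Gq : chi c ^+ 2 * g ^+ q = g'.
  by rewrite gq -[RHS]S2; under eq_bigr do rewrite chiq.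
have G'q : chi c * g' ^+ q = g.
  by rewrite g'q -[RHS]S1; under eq_bigr do rewrite chiq (cubic_char_exp4 _ chiP).
rewrite Aq Bq => E.
have /(mulIf (_ : be * g' != 0)) : chi c * (be * g') = 1 * (be * g').
  rewrite mul1r -{2}Gq.
  transitivity (chi c ^+ 2 * (be * g ^+ q)); last by ring.
  rewrite E.
  transitivity ((w ^+ 2) ^+ i * chi c * (al * (chi c * g' ^+ q))); last by ring.
  rewrite G'q Di.
  transitivity ((w ^+ 3) ^+ i * (chi c * (be * g'))); last by rewrite exprS exprMn; ring.
  by rewrite w3 expr1n mul1r.
by apply; rewrite mulf_neq0.
Qed.

(* [H] stands for [x (x - 1) / 2], which keeps the form integral. *)
Lemma cubic_residue_form_exists p : prime p -> (p %% 3 = 1)%N ->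
  exists L M : int, L ^+ 2 + 27%:Z * M ^+ 2 = 4%:Z * p%:Z /\
    forall (q : nat) (x H : int), prime q -> q != p -> q != 3 ->
      x ^+ 2 - x = 2%:Z * H ->
      (q%:Z %| L * H + M * (H - 1) * (2%:Z * x - 1))%Z -> cubic_residue p q.
Proof.
move=> pp p1.
have [|e eP] := @exists_cubic_index 'F_p; first by rewrite card_Fp //; lia.
have /dvdnP[n1 N1] := dvdn_jacobi_count eP (isT : (0 < 1 < 3)%N).
have /dvdnP[n2 N2] := dvdn_jacobi_count eP (isT : (0 < 2 < 3)%N).
have := jacobi_count_norm pp eP erefl erefl; rewrite N1 N2.
set n0 := jacobi_count e 0 => norm.
pose a := n0%:Z - (3 * n2)%N%:Z; pose M := n1%:Z - n2%:Z.
(* With [b = 3 M], [4 (a ^ 2 - a b + b ^ 2) = (2 a - b) ^ 2 + 3 b ^ 2] is [L ^ 2 + 27 M ^ 2]. *)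
exists (2%:Z * a - 3%:Z * M), M; split.
  by rewrite -norm /a /M !PoszM; ring.
move=> q x H pq qp q3 DH /dvdzP[k Dk].
suff ec : (e q%:R %% 3 = 0)%N.
  have c0 : (q%:R : 'F_p) != 0.
    by rewrite -(dvdn_pcharf (pchar_Fp pp)) dvdn_prime2 // eq_sym.
  have [_ _ eC] := eP; have [y Dy] := eC _ c0 ec.
  split; first by apply/eqP; rewrite -/(dvdn p q) dvdn_prime2 // eq_sym.
  exists y; have := congr1 (@nat_of_ord _) Dy.
  (* [^] in [cubic_residue] is [Nat.pow], not MathComp's [expn]. *)
  have -> : PeanoNat.Nat.pow y 3 = (y ^ 3)%N.
    by transitivity (y * (y * (y * 1)))%N => //; rewrite muln1.
  by rewrite -[y in y ^+ 3]natr_Zp -natrX !val_Fp_nat.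
(* An algebraic closure in characteristic [q] contains primitive roots of unity of orders 3 and [p],
   because [q] differs from both. *)
have [F [FtoK _]] := countable_algebraic_closure 'F_q.
have qF : q \in [pchar F] := rmorph_pchar FtoK (pchar_Fp pq).
have p30 : (3 * p)%:R != 0 :> F.
  by rewrite -(dvdn_pcharf qF) Euclid_dvdM // !dvdn_prime2 // negb_or q3.
have [r rP] := closed_prim_root_exists p30.
have wP : 3.-primitive_root (r ^+ p).
  by have := dvdn_prim_root rP (dvdn_mulr p (dvdnn 3)); rewrite mulKn.
have zP : p.-primitive_root (r ^+ 3).
  by have := dvdn_prim_root rP (dvdn_mull 3 (dvdnn p)); rewrite mulnK // prime_gt0.
set w := r ^+ p in wP.
have w2P : 3.-primitive_root (w ^+ 2) by rewrite prim_root_exp_coprime.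
have := frobenius_cubic_char (x := x) pp pq qp q3 qF eP wP zP.
rewrite !jacobi_sum_index // N1 N2 -/n0.
have Dw : w ^+ 2 = - w - 1 by apply/eqP; rewrite -subr_eq0 -(prim3_root_sum wP); apply/eqP; ring.
(* The left side is the coefficient of [w] in [(x + w) ^ 3 (a + 3 M w)] once [w ^ 2] is eliminated,
   and equals 3 times the form. Times [w - w ^ 2] it is the difference of the two sides required by
   [frobenius_cubic_char]. *)
have I : (x ^+ 3 - 3%:Z * x + 1) * (3%:Z * M) + (3%:Z * x ^+ 2 - 3%:Z * x) * (a - 3%:Z * M)
   = 3%:Z * k * q%:Z.
  rewrite -mulrA -Dk.
  have -> : 3%:Z * x ^+ 2 - 3%:Z * x = 3%:Z * (2%:Z * H) by rewrite -DH; ring.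
  have -> : x ^+ 3 = x * (2%:Z * H) + 2%:Z * H + x by rewrite -DH; ring.
  ring.
have {}I : (x%:~R ^+ 3 - 3 * x%:~R + 1) * (3 * (n1%:R - n2%:R)) +
   (3 * x%:~R ^+ 2 - 3 * x%:~R) * (n0%:R - 3 * n2%:R - 3 * (n1%:R - n2%:R)) = 0 :> F.
  have q0 : q%:~R = 0 :> F by apply/eqP; rewrite -pmulrn -(dvdn_pcharf qF).
  have := congr1 (fun t : int => t%:~R : F) I.
  rewrite /= !rmorphM /= q0 mulr0 => <-.
  by rewrite /a /M PoszM !(rmorphD, rmorphB, rmorphM, rmorphXn) /= -!pmulrn; ring.
move=> key; have: index_char e w (q%:R : 'F_p) = 1.
  apply: key; rewrite !natrM; apply/eqP; rewrite -subr_eq0; apply/eqP.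
  transitivity ((w - w ^+ 2) * 0); last by rewrite mulr0.
  by rewrite -I -![in LHS](exprAC w) !Dw; ring: Dw.
rewrite /index_char; case: eqP => [|_ /eqP]; first by move=> _ /esym/eqP; rewrite oner_eq0.
by rewrite -(prim_order_dvd wP) => /eqP.
Qed.

(** * Prime divisors of the values of the cubic form *)

(** The two values are linear in [L] and [M] with determinant [D], up to sign, so [q ^ k] divides
    [L D] and [M D]. The product in the conclusion is [2 D], and its square times [p] is
    [(L D) ^ 2 + 27 (M D) ^ 2]; thus [q = 2] and [q = 3] are no exceptions. *)
Lemma cubic_form_resultant (p q k : nat) (L M x z H K : int) :
  prime q -> prime p -> q != p ->
  L ^+ 2 + 27%:Z * M ^+ 2 = 4%:Z * p%:Z ->
  x ^+ 2 - x = 2%:Z * H -> z ^+ 2 - z = 2%:Z * K ->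
  ((q ^ k)%N%:Z %| L * H + M * (H - 1) * (2%:Z * x - 1))%Z ->
  ((q ^ k)%N%:Z %| L * K + M * (K - 1) * (2%:Z * z - 1))%Z ->
  ((q ^ k)%N%:Z %| (z - x) * (x * z - z + 1) * (x * z - x + 1))%Z.
Proof.
move=> pq pp qp norm DH DK /dvdzP[a Da] /dvdzP[b Db].
set E := (_ * _ * _); set Q := (q ^ k)%N%:Z in Da Db *.
pose D := H * ((K - 1) * (2%:Z * z - 1)) - K * ((H - 1) * (2%:Z * x - 1)).
have DE : E = 2%:Z * D.
  apply: (@mulfI _ 2%:Z) => //.
  transitivity ((2%:Z * H) * ((2%:Z * K - 2%:Z) * (2%:Z * z - 1))
     - (2%:Z * K) * ((2%:Z * H - 2%:Z) * (2%:Z * x - 1))); last by rewrite /D; ring.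
  by rewrite -DH -DK /E; ring.
have EL : L * D = Q * (a * ((K - 1) * (2%:Z * z - 1)) - b * ((H - 1) * (2%:Z * x - 1))).
  transitivity ((a * Q) * ((K - 1) * (2%:Z * z - 1)) - (b * Q) * ((H - 1) * (2%:Z * x - 1))).
    by rewrite -Da -Db /D; ring.
  by ring.
have EM : M * D = Q * (b * H - a * K).
  transitivity ((b * Q) * H - (a * Q) * K); first by rewrite -Da -Db /D; ring.
  by ring.
have : (Q ^+ 2 %| p%:Z * E ^+ 2)%Z.
  have -> : p%:Z * E ^+ 2 = (L * D) ^+ 2 + 27%:Z * (M * D) ^+ 2.
    transitivity ((L ^+ 2 + 27%:Z * M ^+ 2) * D ^+ 2); last by ring.
    by rewrite norm DE; ring.
  rewrite EL EM !exprMn; apply: rpredD; first exact: dvdz_mulr.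
  by rewrite mulrCA dvdz_mulr.
rewrite /Q !dvdzE (abszM p%:Z) !abszX !absz_nat Gauss_dvdr.
  by rewrite dvdn_pexp2r.
by rewrite !coprimeXl // prime_coprime // dvdn_prime2.
Qed.

Local Close Scope ring_scope.

(** * Valuations away from an exceptional position *)

Lemma exists_argmax (f : nat -> nat) N : 0 < N ->
  exists2 c, 0 < c <= N & forall t, 0 < t <= N -> f t <= f c.
Proof.
elim: N => // -[|N] IH _.
  by exists 1 => // t; case: t => [|[|t]].
have [c cN cP] := IH isT; case: (leqP (f c) (f N.+2)) => fc; [exists N.+2 | exists c].
- by rewrite leqnn.
- move=> t tN; case: (ltngtP t N.+2) => [lt|gt|-> //]; last by lia.
  by apply: leq_trans fc; apply: cP; lia.
- by lia.
move=> t tN; case: (ltngtP t N.+2) => [lt|gt|->]; [apply: cP; lia|lia|exact: ltnW].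
Qed.

Lemma dist_gt0 (t c : nat) : t != c -> 0 < `|t - c|.
Proof. lia. Qed.

(** Take for [c] a position of maximal valuation: the [q]-part of [e t] then divides [e c] as well,
    hence also the distance. *)
Lemma logn_le_dist q (e : nat -> nat) N : prime q -> 0 < N ->
  (forall t, 0 < t <= N -> 0 < e t) ->
  (forall k t s, 0 < t <= N -> 0 < s <= N ->
     q ^ k %| e t -> q ^ k %| e s -> q ^ k %| `|t - s|) ->
  exists2 c, 0 < c <= N &
    forall t, 0 < t <= N -> t != c -> logn q (e t) <= logn q `|t - c|.
Proof.
move=> pq N0 e0 eP; have [c cN cP] := exists_argmax (fun t => logn q (e t)) N0.
exists c => // t tN tc; rewrite -pfactor_dvdn ?dist_gt0 //.
by apply: eP; rewrite // pfactor_dvdn ?e0 ?cP.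
Qed.

(** A power of [q] dividing a value is coprime to [z], so it can be cancelled from the difference
    [z (t - s)] of two values. *)
Lemma linear_logn_le_dist q z v N : prime q -> 0 < N ->
  exists2 c, 0 < c <= N &
    forall t, 0 < t <= N -> t != c -> logn q (z * (t + v) + 1) <= logn q `|t - c|.
Proof.
move=> pq N0; apply: logn_le_dist => // [t _|k t s _ _ dt ds]; first by lia.
have cop : coprime (q ^ k) z.
  rewrite /coprime -dvdn1 -(@dvdn_addr (z * (t + v))).
    by rewrite (dvdn_trans (dvdn_gcdl _ _)).
  by rewrite dvdn_mulr // dvdn_gcdr.
rewrite -(Gauss_dvdr _ cop).
have -> : z * `|t - s| = `|(z * (t + v) + 1) - (z * (s + v) + 1)|.
  rewrite -[z in LHS]absz_nat -abszM; congr absz; rewrite !PoszD !PoszM !PoszD; ring.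
by rewrite -[_ %| _]/((Posz (q ^ k)) %| _)%Z rpredB.
Qed.


(* The three factors reflect that the roots of the form are permuted by
   [x |-> 1 / (1 - x)]; they replace an analysis of the roots modulo [q ^ k]. *)

(* The size conditions are squared to avoid the square root of [p]. *)
Definition residue_sequence (p n : nat) (S : nat -> nat) : Prop :=
  [/\ forall t, 0 < t <= 5 * n -> p * t ^ 4 <= S t ^ 2 <= 72 ^ 2 * (p * n ^ 6),
      forall t q, 0 < t <= 5 * n -> prime q -> q != 3 -> q %| S t -> cubic_residue p q
    & forall q, prime q -> exists c1 c2 c3 : nat,
        [/\ 0 < c1 <= 5 * n, 0 < c2 <= 5 * n, 0 < c3 <= 5 * n
          & forall t, 0 < t <= 5 * n -> t != c1 -> t != c2 -> t != c3 ->
            logn q (S t) <= logn q `|t - c1| + logn q `|t - c2| + logn q `|t - c3|]].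

(* [cubic_seq] is the cubic form at [x = t + 3], where both of its terms are positive;
   [half_prod t] is [x (x - 1) / 2]. *)
Definition half_prod (t : nat) : nat := ((t + 2) * (t + 3))./2.

Definition cubic_seq (l m t : nat) : nat :=
  l * half_prod t + m * ((half_prod t - 1) * (2 * t + 5)).

Lemma half_prodE t : 2 * half_prod t = (t + 2) * (t + 3).
Proof.
rewrite /half_prod mul2n -[RHS]odd_double_half.
suff -> : odd ((t + 2) * (t + 3)) = false by [].
by rewrite oddM !oddD /=; case: (odd t).
Qed.

Lemma half_prod_gt2 t : 2 < half_prod t.
Proof. have := half_prodE t; nia. Qed.

Lemma cubic_seqE l m t :
  Posz (cubic_seq l m t) = (l%:Z * (half_prod t)%:Z
    + m%:Z * ((half_prod t)%:Z - 1) * (2%:Z * (t + 3)%N%:Z - 1))%R.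
Proof.
have h := half_prod_gt2 t; rewrite /cubic_seq PoszD !PoszM -subzn; last by lia.
by rewrite !PoszD; ring.
Qed.

Lemma half_prodEz t :
  ((t + 3)%N%:Z ^+ 2 - (t + 3)%N%:Z = 2%:Z * (half_prod t)%:Z)%R.
Proof. rewrite -(PoszM 2 (half_prod t)) half_prodE PoszM !PoszD; ring. Qed.

(** This is multiplicativity of the form [X ^ 2 + 27 Y ^ 2], applied to [4 p] and to [(2 H + 1) ^ 3
    = ((H - 1) (2 x - 1)) ^ 2 + 27 H ^ 2], where [2 H = x ^ 2 - x]. *)
Lemma cubic_seq_norm p l m t : l ^ 2 + 27 * m ^ 2 = 4 * p ->
  ((4%:Z * p%:Z) * (2%:Z * (half_prod t)%:Z + 1) ^+ 3 =
  (l%:Z * ((half_prod t)%:Z - 1) * (2%:Z * (t + 3)%N%:Z - 1)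
    - 27%:Z * m%:Z * (half_prod t)%:Z) ^+ 2
  + 27%:Z * (cubic_seq l m t)%:Z ^+ 2)%R.
Proof.
move=> norm; have {}norm : (4%:Z * p%:Z = l%:Z ^+ 2 + 27%:Z * m%:Z ^+ 2)%R by lia.
rewrite norm cubic_seqE; have D := half_prodEz t.
move: (Posz (half_prod t)) (Posz (t + 3)) (Posz l) (Posz m) D => H x L M D.
have N : ((2%:Z * H + 1) ^+ 3 = ((H - 1) * (2%:Z * x - 1)) ^+ 2 + 27%:Z * H ^+ 2)%R.
  have -> : (((H - 1) * (2%:Z * x - 1)) ^+ 2 = (H - 1) ^+ 2 * (4%:Z * (x ^+ 2 - x) + 1))%R by ring.
  by rewrite D; ring.
by rewrite N; ring.
Qed.

(** If [p] divided the value, both squares in [cubic_seq_norm] would be divisible by [p ^ 2], so [p]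
    would divide [4 N ^ 3] with [0 < N < p] and [p] odd. *)
Lemma cubic_seq_prime_ndvd p l m t : prime p -> 2 < p ->
  l ^ 2 + 27 * m ^ 2 = 4 * p -> 2 * half_prod t + 1 < p -> ~~ (p %| cubic_seq l m t).
Proof.
move=> pp p2 norm small; apply/negP => /dvdnP[k Dk].
have := cubic_seq_norm t norm; set u := (_ - _)%R; rewrite Dk.
set N := (_ + 1)%R => E.
have pu : (Posz p %| u)%Z.
  have : (Posz p %| (u ^+ 2)%R)%Z.
    apply/dvdzP; exists (4%:Z * N ^+ 3 - 27%:Z * k%:Z ^+ 2 * p%:Z)%R.
    have -> : (u ^+ 2 = (4%:Z * p%:Z) * N ^+ 3 - 27%:Z * (k * p)%N%:Z ^+ 2)%R by rewrite E; ring.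
    by rewrite PoszM; ring.
  by rewrite !dvdzE abszX Euclid_dvdX // andbT.
case/dvdzP: pu => v Dv.
have : (Posz p %| (4%:Z * N ^+ 3)%R)%Z.
  apply/dvdzP; exists (v ^+ 2 + 27%:Z * k%:Z ^+ 2)%R.
  apply: (@mulfI _ (Posz p)); first by rewrite eqz_nat; lia.
  transitivity ((4%:Z * p%:Z) * N ^+ 3)%R; first by ring.
  by rewrite E Dv PoszM; ring.
rewrite dvdzE (abszM (Posz 4)) abszX !absz_nat Euclid_dvdM // Euclid_dvdX // andbT.
rewrite -[4]/(2 ^ 2) Euclid_dvdX // andbT dvdn_prime2 // [p == 2]gtn_eqF //=.
by move/dvdn_leq; lia.
Qed.

Lemma cubic_seq_bounds p n l m t : 74 < n -> 0 < t <= 5 * n ->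
  l ^ 2 + 27 * m ^ 2 = 4 * p ->
  p * t ^ 4 <= cubic_seq l m t ^ 2 <= 72 ^ 2 * (p * n ^ 6).
Proof.
move=> n75 t0 norm; have h2 := half_prod_gt2 t; have hE := half_prodE t.
apply/andP; split.
  set h := half_prod t in h2 hE *.
  (* For [t >= 1], [h >= 6] and the base on the right is at least [35 h / 6]. The cross term of the
     square is then dropped, leaving [4 p h ^ 2]. *)
  have : 27 * h ^ 2 <= ((h - 1) * (2 * t + 5)) ^ 2.
    have a : 7 * (h - 1) <= (h - 1) * (2 * t + 5) by nia.
    have b : 5 * h <= 6 * (h - 1) by nia.
    nia.
  rewrite /cubic_seq -/h; move: ((h - 1) * _) => P hP.
  have : p * (2 * h) ^ 2 <= (l * h + m * P) ^ 2.
    have -> : p * (2 * h) ^ 2 = (l * h) ^ 2 + m ^ 2 * (27 * h ^ 2).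
      transitivity ((4 * p) * h ^ 2); [ring | rewrite -norm; ring].
    have -> : (l * h + m * P) ^ 2 = (l * h) ^ 2 + m ^ 2 * P ^ 2 + 2 * l * h * m * P by ring.
    by rewrite -[leqLHS]addn0 leq_add // leq_add2l leq_mul2l hP orbT.
  apply: leq_trans; rewrite leq_mul2l -[4]/(2 * 2) expnM leq_exp2r //; apply/orP; right.
  by rewrite hE; nia.
have := cubic_seq_norm t norm.
set u := (_ - _)%R => E.
have {E} : 27 * cubic_seq l m t ^ 2 <= 4 * p * (2 * half_prod t + 1) ^ 3.
  have u2 : (0 <= u ^+ 2)%R by rewrite exprn_even_ge0.
  lia.
have : (2 * half_prod t + 1) ^ 3 <= (t + 3) ^ 6.
  by rewrite -[6]/(2 * 3) expnM leq_exp2r // hE; nia.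
(* Here [t + 3 <= 26 n / 5]; the final constant works because
   [4 * 26 ^ 6 <= 27 * 5 ^ 6 * 72 ^ 2]. *)
have : 5 ^ 6 * (t + 3) ^ 6 <= 26 ^ 6 * n ^ 6.
  by rewrite -!expnMn leq_exp2r //; lia.
move: (_ ^ 3) ((t + 3) ^ 6) (n ^ 6) (cubic_seq _ _ _ ^ 2) => A B C S h1 h3 h4.
have h5 : 5 ^ 6 * (4 * p * A) <= 4 * p * (26 ^ 6 * C).
  rewrite mulnCA leq_mul2l; apply/orP; right; apply: leq_trans h1.
  by rewrite leq_mul2l h3 orbT.
have h6 : 5 ^ 6 * (27 * S) <= 5 ^ 6 * (4 * p * A) by rewrite leq_mul2l h4 orbT.
have := leq_trans h6 h5.
rewrite mulnACA; move: (p * C) => X; lia.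
Qed.

(** The constant is [55 ^ 2], below [75 ^ 2]; it comes from the bound [55 r n ^ 2] on the linear
    sequence. *)
Lemma large_prime_gt p n : 74 < n -> n ^ 6 <= p -> 3025 * n ^ 4 < p.
Proof.
move=> n75; apply: leq_trans; rewrite -[6]/(4 + 2) expnD mulnC ltn_pmul2l.
  nia.
by rewrite expn_gt0; lia.
Qed.

(** As [2 p - 1] is a multiple of 3 and [q ^ (2 p - 1) = q] by Fermat, raising to the power
    [(2 p - 1) / 3] inverts cubing. *)
Lemma cubic_residue_mod3_2 p q : prime p -> (p %% 3 = 2)%N -> ~~ (p %| q) ->
  cubic_residue p q.
Proof.
move=> pp p2 npq; split; first by apply/eqP.
exists (q ^ ((2 * p - 1) %/ 3)).
have -> : forall y, PeanoNat.Nat.pow y 3 = (y ^ 3)%N.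
  by move=> y; transitivity (y * (y * (y * 1)))%N => //; rewrite muln1.
rewrite -expnM divnK; last by lia.
have p0 := prime_gt0 pp.
have -> : (2 * p - 1 = p + p.-1)%N by lia.
rewrite expnD -modnMml fermat_little // modnMml -expnS prednK //.
by rewrite fermat_little.
Qed.

Lemma exists_residue_sequence_mod3_2 p n : prime p -> (p %% 3 = 2)%N ->
  74 < n -> n ^ 6 <= p -> exists S, residue_sequence p n S.
Proof.
move=> pp p2 n75 np; have np4 := large_prime_gt n75 np.
have [r /andP[rp pr]] : exists r, r ^ 2 <= p < r.+1 ^ 2.
  have ex : exists r, r ^ 2 <= p by exists 0.
  have bd r : r ^ 2 <= p -> r <= p by nia.
  case: (ex_maxnP ex bd) => r rp rmax; exists r; rewrite rp /= ltnNge.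
  by apply/negP => /rmax; rewrite ltnn.
(* Since [c = (r + 1) (5 n) ^ 2], the lower size bound holds, while [c + t] stays below [p], so that
   [p] divides no value. *)
pose c := 25 * (r + 1) * n ^ 2.
have r75 : 75 < r.
  have n4 : 75 ^ 4 <= n ^ 4 by rewrite leq_exp2r.
  have : 75 ^ 2 * 75 ^ 2 < r.+1 ^ 2 by rewrite -expnD; lia.
  nia.
have cS t : t <= 5 * n -> c + t <= 55 * r * n ^ 2 by move=> t5; rewrite /c; nia.
exists (fun t => c + t); split.
- move=> t /andP[t0 t5]; apply/andP; split.
    apply: leq_trans (_ : (r + 1) ^ 2 * (5 * n) ^ 4 <= _).
      by apply: leq_mul; [rewrite addn1 ltnW | rewrite leq_exp2r].
    have -> : (r + 1) ^ 2 * (5 * n) ^ 4 = c ^ 2 by rewrite /c; ring.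
    by rewrite leq_exp2r // leq_addr.
  apply: leq_trans (_ : (72 * r * n ^ 3) ^ 2 <= _).
    rewrite leq_exp2r //; apply: leq_trans (cS t t5) _.
    by rewrite (expnS n 2) -!mulnA; apply: leq_mul => //; rewrite leq_mul2l leq_pmull ?orbT //; lia.
  have -> : (72 * r * n ^ 3) ^ 2 = 72 ^ 2 * (r ^ 2 * n ^ 6) by rewrite (expnMn (72 * r)) (expnMn 72) -(expnM n) mulnA.
  by rewrite leq_mul2l leq_mul2r rp !orbT.
- move=> t q /andP[t0 t5] pq q3 qS; apply: cubic_residue_mod3_2 => //.
  rewrite dvdn_prime2 //; apply: contraTneq qS => <-.
  rewrite gtnNdvd //; first lia.
  rewrite -(@ltn_exp2r _ _ 2) //.
  apply: leq_ltn_trans (_ : (55 * r * n ^ 2) ^ 2 < _); first by rewrite leq_exp2r // cS.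
  have -> : (55 * r * n ^ 2) ^ 2 = r ^ 2 * (3025 * n ^ 4) by ring.
  apply: leq_ltn_trans (_ : p * (3025 * n ^ 4) < _); first by rewrite leq_mul2r rp orbT.
  by rewrite -mulnn ltn_pmul2l // prime_gt0.
move=> q pq; have N0 : 0 < 5 * n by lia.
have [|k t s _ _ dt ds|d dN dP] := @logn_le_dist q (fun t => c + t) (5 * n) pq N0.
- by move=> t; lia.
- have -> : `|t - s| = `|(c + t) - (c + s)|%N by congr absz; lia.
  by rewrite -[_ %| _]/((Posz (q ^ k)) %| _)%Z rpredB.
exists d, d, d; split=> // t tN td _ _; apply: leq_trans (dP t tN td) _.
by rewrite -addnA leq_addr.
Qed.

Lemma exists_residue_sequence_mod3_1 p n : prime p -> (p %% 3 = 1)%N ->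
  74 < n -> n ^ 6 <= p -> exists S, residue_sequence p n S.
Proof.
move=> pp p1 n75 np; have np4 := large_prime_gt n75 np.
have [L [M [norm LMP]]] := cubic_residue_form_exists pp p1.
pose l := absz L; pose m := absz M.
have lm : l ^ 2 + 27 * m ^ 2 = 4 * p.
  have sq (k : int) : Posz (absz k ^ 2) = (k ^+ 2)%R.
    by rewrite -abszX gez0_abs // sqr_ge0.
  by have := sq L; have := sq M; rewrite -/l -/m; lia.
have small t : t <= 5 * n -> 2 * half_prod t + 1 < p.
  move=> t5; rewrite half_prodE addn1; apply: leq_ltn_trans np4.
  apply: leq_trans (_ : (6 * n) * (6 * n) <= _); first by rewrite ltn_mul //; lia.
  by rewrite mulnACA leq_mul // mulnn leq_pexp2l //; lia.
have p_gt2 : 2 < p by have := small 0 isT; have := half_prod_gt2 0; lia.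
have ndvd t : t <= 5 * n -> ~~ (p %| cubic_seq l m t).
  by move=> t5; rewrite cubic_seq_prime_ndvd // small.
(* Replacing [x] by [1 - x] changes the sign of [M], so [L] and [M] may be taken positive. *)
have signed t : exists x : int,
    (x ^+ 2 - x = 2%:Z * (half_prod t)%:Z)%R /\
    absz (L * (half_prod t)%:Z + M * ((half_prod t)%:Z - 1) * (2%:Z * x - 1))%R
      = cubic_seq l m t.
  have D := half_prodEz t; have := cubic_seqE l m t; rewrite /l /m => E.
  have [s2 s2E] : exists b : bool, (M = (-1) ^+ b * (absz M)%:Z)%R.
    by exists (M < 0)%R; rewrite -intEsign.
  have [s1 s1E] : exists b : bool, (L = (-1) ^+ b * (absz L)%:Z)%R.
    by exists (L < 0)%R; rewrite -intEsign.
  exists (if s1 == s2 then (t + 3)%N%:Z else 1 - (t + 3)%N%:Z)%R; split.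
    by case: (s1 == s2); rewrite // -D; ring.
  rewrite -[RHS]absz_nat E {1}s1E {1}s2E.
  by case: s1 {s1E}; case: s2 {s2E} => /=; rewrite ?expr0 ?expr1;
    first [congr absz; ring | rewrite -abszN; congr absz; ring].
have zdvd k t s q : prime q -> q != p -> q ^ k %| cubic_seq l m t ->
    q ^ k %| cubic_seq l m s ->
    q ^ k %| `|t - s| * ((t + 3) * (s + 2) + 1) * ((s + 3) * (t + 2) + 1).
  move=> pq qp dt ds.
  have lmz : (l%:Z ^+ 2 + 27%:Z * m%:Z ^+ 2 = 4%:Z * p%:Z)%R.
    by move: (l) (m) lm => a b; clear; lia.
  have := @cubic_form_resultant p q k _ _ _ _ _ _ pq pp qp lmz (half_prodEz t) (half_prodEz s).
  rewrite -!cubic_seqE => /(_ dt ds).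
  set E := (_ * _ * _)%R.
  have -> : E = ((s%:Z - t%:Z) * ((t + 3) * (s + 2) + 1)%N%:Z * ((s + 3) * (t + 2) + 1)%N%:Z)%R.
    by rewrite /E !PoszD !PoszM !PoszD; ring.
  by rewrite dvdzE !abszM !absz_nat distnC.
exists (cubic_seq l m); split.
- by move=> t tN; apply: cubic_seq_bounds.
- move=> t q /andP[_ t5] pq q3 qS; have [x [xE SE]] := signed t.
  apply: LMP pq _ q3 xE _; last by rewrite dvdzE SE.
  by apply: contraTneq qS => ->; exact: ndvd.
move=> q pq; have N0 : 0 < 5 * n by lia.
have [->|qp] := eqVneq q p.
  exists 1, 1, 1; split; rewrite ?N0 // => t /andP[t0 t5] _ _ _.
  by rewrite lognE (negPf (ndvd t t5)) !andbF.
(* With [c1] of maximal valuation, the [q]-part of each value divides the product of three factors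
   in [zdvd]. Two of these are linear in [t] of the form [z (t + v) + 1] and supply [c2] and
   [c3]. *)
have [c1 c1N c1P] := exists_argmax (fun t => logn q (cubic_seq l m t)) N0.
have [c2 c2N c2P] := linear_logn_le_dist (c1 + 3) 2 pq N0.
have [c3 c3N c3P] := linear_logn_le_dist (c1 + 2) 3 pq N0.
exists c1, c2, c3; split=> // t tN t1 t2 t3.
have S0 s : 0 < s <= 5 * n -> 0 < cubic_seq l m s.
  move=> /andP[_ s5]; rewrite lt0n; apply: contra (ndvd s s5) => /eqP ->.
  exact: dvdn0.
apply: leq_trans (_ : logn q (`|t - c1| * ((c1 + 3) * (t + 2) + 1) * ((c1 + 2) * (t + 3) + 1)) <= _).
  rewrite -pfactor_dvdn ?muln_gt0 ?dist_gt0 ?addn_gt0 ?orbT //.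
  rewrite mulnAC [(c1 + 2) * _]mulnC; apply: zdvd; rewrite ?pfactor_dvdn ?S0 //.
  exact: c1P.
rewrite !lognM ?muln_gt0 ?dist_gt0 ?addn_gt0 ?orbT //.
by rewrite !leq_add // ?c2P ?c3P.
Qed.

Lemma exists_residue_sequence p n : prime p -> 74 < n -> n ^ 6 <= p ->
  exists S, residue_sequence p n S.
Proof.
move=> pp n75 np; have n4 : 0 < n ^ 4 by rewrite expn_gt0; lia.
have p75 : 75 < p by have := large_prime_gt n75 np; lia.
have : ~~ (3 %| p) by rewrite dvdn_prime2 //; lia.
rewrite /dvdn.
have : p %% 3 < 3 by rewrite ltn_mod.
case E: (p %% 3) => [|[|[|]]] // _ _.
  exact: exists_residue_sequence_mod3_1.
exact: exists_residue_sequence_mod3_2.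
Qed.

(** * Counting large prime divisors *)

Lemma seq_choice (A : eqType) (B : Type) (R : A -> B -> Prop) (s : seq A) (b0 : B) :
  (forall a, a \in s -> exists b, R a b) -> exists f, forall a, a \in s -> R a (f a).
Proof.
elim: s => [|a s IH] H; first by exists (fun=> b0).
have [f fP] := IH (fun x xs => H x (mem_behead (s := a :: s) xs)).
have [b bP] := H a (mem_head _ _).
exists (fun x => if x == a then b else f x) => x; rewrite inE.
by case: eqVneq => [-> _|_] //=; apply: fP.
Qed.

(** There are four primes up to 9, and two consecutive larger integers contain at most one. *)
Lemma count_prime_le_half n : 8 < n -> count prime (iota 0 n.+1) <= n./2.
Proof.
move=> n8; have -> : n = n - 9 + 9 by lia.
move: (n - 9) => k; elim/ltn_ind: k => -[|[|k]] IH //.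
have -> : (k.+2 + 9).+1 = (k + 9).+1 + 2 by lia.
rewrite iotaD count_cat add0n.
have : count prime (iota (k + 9).+1 2) <= 1.
  rewrite /= addn0; case: (boolP (prime _)) => // p1; case: (boolP (prime _)) => // p2.
  have := even_prime p1; have := even_prime p2; rewrite /=; lia.
by have := IH k (ltnW (ltnSn _)); lia.
Qed.

Lemma logn_fact_sum q n : logn q n`! = \sum_(1 <= j < n.+1) logn q j.
Proof.
elim: n => [|n IH]; first by rewrite big_nil logn1.
by rewrite big_nat_recr //= -IH factS lognM ?fact_gt0 // addnC.
Qed.

(** The distances multiply to [(c - 1)! (N - c)!], which divides [(N - 1)!] with a binomial
    coefficient as quotient. *)
Lemma sum_logn_dist q N c : 0 < c <= N ->
  \sum_(1 <= t < N.+1 | t != c) logn q `|t - c| <= logn q N`!.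
Proof.
case/andP=> c0 cN.
have -> : \sum_(1 <= t < N.+1 | t != c) logn q `|t - c|
    = logn q (c.-1)`! + logn q (N - c)`!.
  rewrite (@big_cat_nat _ _ _ c) //=; last by lia.
  rewrite [X in _ + X](@big_cat_nat _ _ _ c.+1) //=.
  rewrite [X in _ + (X + _)]big1_seq ?add0n; last first.
    by move=> t; rewrite mem_index_iota => /andP[tc]; lia.
  rewrite !logn_fact_sum; congr (_ + _).
    rewrite (prednK c0) big_nat_rev [LHS]big_nat_cond [RHS]big_nat_cond.
    apply: eq_big => t; first by apply/idP/idP => H; lia.
    by move=> H; congr logn; lia.
  rewrite -[in index_iota c.+1 _]add1n big_addn subSn //.
  rewrite big_nat_cond [RHS]big_nat_cond; apply: eq_big => t; first by apply/idP/idP => H; lia.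
  by move=> H; congr logn; lia.
rewrite -lognM ?fact_gt0 //; apply: dvdn_leq_log; first exact: fact_gt0.
have cN' : c.-1 <= N.-1 by lia.
have := bin_fact cN'; have -> : N.-1 - c.-1 = N - c by lia.
move=> E; apply: (@dvdn_trans (N.-1)`!); first by rewrite -E dvdn_mull.
by case: (N) => // k; rewrite factS dvdn_mull.
Qed.

Lemma prod_logn B m : 0 < m <= B -> m = \prod_(q <- iota 0 B.+1) q ^ logn q m.
Proof.
case/andP=> m0 mB; rewrite -{1}(partnT m0) (widen_partn _ mB) /index_iota subn0.
by apply: eq_bigl.
Qed.

(** The [i]-th smallest selected integer is at least [i]. *)
Lemma fact_le_prod N (G : pred nat) :
  (count G (iota 1 N))`! <= \prod_(t <- iota 1 N | G t) t.
Proof.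
elim: N => [|N IH]; first by rewrite big_nil.
rewrite -(addn1 N) iotaD count_cat big_cat /= big_cons big_nil add1n addn0.
case: (G N.+1) => /=; last by rewrite addn0 muln1.
rewrite addn1 factS mulnC leq_mul //.
by rewrite muln1 ltnS (leq_trans (count_size _ _)) // size_iota.
Qed.

Lemma prod_le_expn (A : eqType) (s : seq A) (P : pred A) (F : A -> nat) B k :
  0 < B -> (forall a, a \in s -> P a -> F a <= B) -> count P s <= k ->
  \prod_(a <- s | P a) F a <= B ^ k.
Proof.
move=> B0 FB ck; apply: leq_trans (_ : B ^ count P s <= _); last exact: leq_pexp2l.
rewrite -big_filter -size_filter.
have : {in filter P s, forall a, F a <= B}.
  by move=> a; rewrite mem_filter => /andP[Pa aS]; apply: FB.
elim: (filter P s) => [|a r IH] H; first by rewrite big_nil.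
rewrite big_cons /= expnS leq_mul ?H ?mem_head // IH // => b br.
by apply: H; rewrite inE br orbT.
Qed.

(** Each of the at most three positions in [c] contributes at most [B]; at the others,
    [sum_logn_dist] is used once per exceptional position. Squaring turns the exponent 3 of the
    factorial into 6. *)
Lemma prime_prod_le N q B (S : nat -> nat) (G : pred nat) (c : seq nat) :
  prime q -> 0 < B -> size c <= 3 -> all (fun x => 0 < x <= N) c ->
  (forall t, 0 < t <= N -> 0 < S t /\ S t ^ 2 <= B) ->
  (forall t, 0 < t <= N -> t \notin c -> logn q (S t) <= \sum_(x <- c) logn q `|t - x|) ->
  \prod_(t <- iota 1 N | G t) (q ^ logn q (S t)) ^ 2 <=
  (q ^ logn q N`!) ^ 6 * 
    (if has (fun t => [&& G t, t \in c & q %| S t]) (iota 1 N) then B ^ 3 else 1).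
Proof.
move=> pq B0 c3 cN SB Sc; have q0 := prime_gt0 pq.
rewrite (bigID (mem c)) [leqRHS]mulnC /=; apply: leq_mul; last first.
  apply: leq_trans (_ : \prod_(t <- iota 1 N | t \notin c)
     (q ^ (\sum_(x <- c) logn q `|t - x|)) ^ 2 <= _).
    rewrite [leqRHS](bigID G) /= [leqLHS]big_seq_cond -[leqLHS]muln1; apply: leq_mul.
      rewrite [leqRHS]big_seq_cond.
      under [leqRHS]eq_bigl do rewrite [(_ \notin _) && _]andbC.
      apply: leq_prod => t /andP[tN /andP[_ tc]]; rewrite leq_exp2r // leq_pexp2l // Sc //.
      by move: tN; rewrite mem_iota; lia.
    by rewrite prodn_cond_gt0 // => t _; rewrite !expn_gt0 q0.
  rewrite -expnM; under eq_bigr do rewrite -expnM.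
  rewrite -expn_sum leq_pexp2l // -big_distrl /= -[6]/(3 * 2) mulnA leq_mul2r /=.
  rewrite exchange_big /=.
  apply: leq_trans (_ : \sum_(x <- c) logn q N`! <= _); last first.
    by rewrite big_const_seq count_predT iter_addn_0 leq_mul2l c3 orbT.
  rewrite big_seq [leqRHS]big_seq; apply: leq_sum => x xc.
  apply: leq_trans (sum_logn_dist q (allP cN x xc)).
  rewrite /index_iota subSS subn0 [leqRHS](bigID (fun t => t \notin c)) /=.
  apply: leq_trans (leq_addr _ _); rewrite leq_eqVlt; apply/orP; left; apply/eqP.
  apply: eq_bigl => t; case: (boolP (t \in c)) => //=; rewrite ?andbF ?andbT //.
  by case: eqVneq => // ->; rewrite xc.
  case: ifP => [_|/hasPn no].
  apply: prod_le_expn => //.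
    move=> t tN _; have [|S0 S2] := SB t; first by move: tN; rewrite mem_iota; lia.
    by apply: leq_trans S2; rewrite leq_exp2r // dvdn_leq // pfactor_dvdnn.
  apply: leq_trans (_ : count (mem c) (iota 1 N) <= _).
    by apply: sub_count => t /andP[].
  rewrite -size_filter; apply: leq_trans c3; apply: uniq_leq_size.
    by rewrite filter_uniq // iota_uniq.
  by move=> t; rewrite mem_filter => /andP[].
  rewrite big_seq_cond big1 // => t /andP[tN /andP[Gt tc]].
have := no t tN; rewrite Gt tc /= => nd.
by rewrite lognE (negPf nd) !andbF.
Qed.

Lemma prod_expn (A : Type) (s : seq A) (P : pred A) (F : A -> nat) k :
  \prod_(a <- s | P a) F a ^ k = (\prod_(a <- s | P a) F a) ^ k.
Proof.
by rewrite (big_morph (fun x => x ^ k) (fun x y => expnMn x y k) (exp1n k)).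
Qed.

Lemma residue_sequence_count p n S : prime p -> 8 < n -> residue_sequence p n S ->
  exists (Qs : seq nat) (g : nat),
    [/\ uniq Qs,
        forall q, q \in Qs -> [/\ prime q, n < q, cubic_residue p q & q ^ 2 <= 72 ^ 2 * (p * n ^ 6)],
        7 * n <= 2 * g
      & p ^ g * g`! ^ 4 <= (5 * n)`! ^ 6 * (72 ^ 2 * (p * n ^ 6)) ^ (3 * size Qs)].
Proof.
move=> pp n8 [SB Sdvd Sexc]; set N := 5 * n in SB Sdvd Sexc *.
set B := 72 ^ 2 * (p * n ^ 6) in SB *.
have p0 := prime_gt0 pp.
have n6 : 0 < n ^ 6 by rewrite expn_gt0; lia.
have B0 : 0 < B by rewrite (muln_gt0 (72 ^ 2)) (muln_gt0 p) p0 n6.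
have SB' t : 0 < t <= N -> 0 < S t /\ S t ^ 2 <= B.
  move=> tN; have /andP[St1 St2] := SB t tN; split=> //.
  have : 0 < S t ^ 2 by apply: leq_trans St1; rewrite muln_gt0 p0 expn_gt0; lia.
  by rewrite expn_gt0 orbF.
pose I := iota 1 N; pose ps := iota 0 B.+1.
have IP t : t \in I = (0 < t <= N) by rewrite mem_iota; lia.
have [f fP] : exists f : nat -> seq nat, forall q, q \in ps -> prime q ->
    [/\ size (f q) <= 3, all (fun x => 0 < x <= N) (f q)
      & forall t, 0 < t <= N -> t \notin f q ->
          logn q (S t) <= \sum_(x <- f q) logn q `|t - x|].
  apply: (seq_choice (R := fun q c => prime q -> [/\ size c <= 3, all (fun x => 0 < x <= N) c
    & forall t, 0 < t <= N -> t \notin c -> logn q (S t) <= \sum_(x <- c) logn q `|t - x|])).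
    exact: [::].
  move=> q _; case: (boolP (prime q)) => [pq|_]; last by exists [::].
  have [c1 [c2 [c3 [c1N c2N c3N cP]]]] := Sexc q pq.
  exists [:: c1; c2; c3] => _; split; rewrite //= ?c1N ?c2N ?c3N // => t tN.
  rewrite !inE !negb_or => /and3P[t1 t2 t3].
  by rewrite !big_cons big_nil addn0 addnA cP.
(* Only positions exceptional for no prime up to [n] are kept, so a factor [B ^ 3] can arise only
   from a prime in [Qs]. *)
pose G t := all (fun q => t \notin f q) [seq q <- iota 0 n.+1 | prime q].
pose Qs := [seq q <- ps | [&& prime q, n < q & has (fun t => q %| S t) I]].
pose g := count G I.
have BN : n <= B.
  apply: leq_trans (leq_pmull _ _) => //; rewrite expnS mulnCA leq_pmulr //.
  by rewrite muln_gt0 p0 expn_gt0; lia.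
have up : \prod_(t <- I | G t) S t ^ 2 <= N`! ^ 6 * B ^ (3 * size Qs).
  pose C := B + N`!.
  apply: leq_trans (_ : \prod_(q <- iota 0 C.+1)
      ((q ^ logn q N`!) ^ 6 * (if q \in Qs then B ^ 3 else 1)) <= _); last first.
    rewrite big_split /= prod_expn -prod_logn ?fact_gt0 ?leq_addl // leq_mul2l.
    apply/orP; right; rewrite -big_mkcond big_const_seq iter_muln_1 -expnM.
    rewrite leq_pexp2l // leq_mul2l /=.
    apply: leq_trans (_ : size [seq q <- iota 0 C.+1 | q \in Qs] <= _).
      by rewrite size_filter.
    apply: uniq_leq_size; first by rewrite filter_uniq // iota_uniq.
    by move=> q; rewrite mem_filter => /andP[].
  apply: leq_trans (_ : \prod_(t <- I | G t) \prod_(q <- iota 0 C.+1) (q ^ logn q (S t)) ^ 2 <= _).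
    rewrite big_seq_cond [leqRHS]big_seq_cond; apply: leq_prod => t /andP[tI _].
    have [|S0 S2] := SB' t; first by rewrite -IP.
    have SC : 0 < S t <= C by rewrite S0 /C; nia.
    by rewrite prod_expn -prod_logn.
  rewrite exchange_big /=; apply: leq_prod => q _.
  have v0 t : t \in I -> ~~ ((q \in ps) && prime q) -> logn q (S t) = 0.
    rewrite IP => tN; have [S0 S2] := SB' t tN; rewrite lognE S0 /=.
    case: (boolP (prime q)) => //= pq; case: (boolP (q %| S t)) => //= qS.
    case/negP; rewrite mem_iota andbT /= add0n ltnS; apply: leq_trans S2.
    by apply: leq_trans (dvdn_leq S0 qS) _; rewrite leq_pmulr.
  case: (boolP ((q \in ps) && prime q)) => [/andP[qps pq]|npq]; last first.
    rewrite big_seq_cond big1 => [|t /andP[tI _]]; last by rewrite v0.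
    have qv : 0 < q ^ logn q N`! by case: (q) => [|k]; rewrite ?expn_gt0 // lognE.
    by rewrite muln_gt0 expn_gt0 qv /=; case: ifP; rewrite // expn_gt0 B0.
  have [c3 cN cP] := fP q qps pq.
  apply: leq_trans (prime_prod_le G pq B0 c3 cN SB' cP) _.
  rewrite leq_mul2l; apply/orP; right; case: ifP => [/hasP[t tI /and3P[Gt tc qS]]|_].
    suff -> : q \in Qs by [].
    rewrite mem_filter qps andbT pq ltnNge; apply/andP; split=> //.
    apply/andP; split; last by apply/hasP; exists t.
    apply/negP => qn; move/allP/(_ q): Gt; rewrite mem_filter pq mem_iota ltnS qn tc.
    by move/(_ isT).
  by case: ifP => _ //; rewrite expn_gt0 B0.
have low : p ^ g * g`! ^ 4 <= \prod_(t <- I | G t) S t ^ 2.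
  apply: leq_trans (_ : \prod_(t <- I | G t) (p * t ^ 4) <= _); last first.
    rewrite big_seq_cond [leqRHS]big_seq_cond; apply: leq_prod => t /andP[tI _].
    by have /andP[] := SB t (etrans (esym (IP t)) tI).
  rewrite big_split /= big_const_seq iter_muln_1 leq_mul2l; apply/orP; right.
  rewrite prod_expn leq_exp2r //; exact: fact_le_prod.
exists Qs, g; split=> //.
- by rewrite filter_uniq // iota_uniq.
- move=> q; rewrite mem_filter => /andP[/and3P[pq nq /hasP[t]]].
  rewrite IP => tN qS _; have [S0 S2] := SB' t tN; split=> //.
    by apply: Sdvd tN pq _ qS; lia.
  by apply: leq_trans S2; rewrite leq_exp2r // dvdn_leq.
- have : count (predC G) I <= 3 * n./2.
    apply: leq_trans (_ : size (flatten [seq f q | q <- iota 0 n.+1 & prime q]) <= _).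
      rewrite -size_filter; apply: uniq_leq_size; first by rewrite filter_uniq // iota_uniq.
      move=> t; rewrite mem_filter => /andP[/= /allPn[q qn]]; rewrite negbK => tf _.
      by apply/flattenP; exists (f q) => //; apply: map_f.
    rewrite size_flatten /shape -map_comp.
    apply: leq_trans (_ : 3 * count prime (iota 0 n.+1) <= _); last first.
      by rewrite leq_mul2l count_prime_le_half.
    rewrite -size_filter mulnC sumnE big_map.
    apply: leq_trans (_ : \sum_(q <- iota 0 n.+1 | prime q) 3 <= _).
      rewrite big_filter big_seq_cond [leqRHS]big_seq_cond; apply: leq_sum => q /andP[qn pq].
      have [|//] := fP q _ pq; move: qn; rewrite !mem_iota; lia.
    by rewrite big_const_seq iter_addn_0 size_filter mulnC.
  have := count_predC G I; rewrite size_iota -/g /N; lia.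
exact: leq_trans low up.
Qed.

(** * Logarithmic estimates *)

From Stdlib Require Import Reals Lra Classical.
Open Scope R_scope.

Lemma INR_muln (m n : nat) : INR (m * n)%nat = INR m * INR n.
Proof. exact: mult_INR. Qed.

Lemma INR_expn (m k : nat) : INR (expn m k) = INR m ^ k.
Proof. by elim: k => [|k IH] //=; rewrite expnS INR_muln IH. Qed.

Lemma INR_gt0 (m : nat) : (0 < m)%nat -> 0 < INR m.
Proof. by move=> /ltP; apply: lt_0_INR. Qed.

Lemma INR_leq (m n : nat) : (m <= n)%nat -> INR m <= INR n.
Proof. by move=> /leP; apply: le_INR. Qed.

Lemma leq_INR (m n : nat) : INR m <= INR n -> (m <= n)%nat.
Proof. by move=> H; apply/leP; apply: INR_le. Qed.

Lemma ln_le x y : 0 < x -> x <= y -> ln x <= ln y.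
Proof. by move=> x0 [xy|->]; [left; apply: ln_increasing | right]. Qed.

Definition lnn (m : nat) : R := ln (INR m).

Lemma lnn_muln (m n : nat) : (0 < m)%nat -> (0 < n)%nat -> lnn (m * n)%nat = lnn m + lnn n.
Proof. by move=> m0 n0; rewrite /lnn INR_muln ln_mult //; apply: INR_gt0. Qed.

Lemma lnn_expn (m k : nat) : (0 < m)%nat -> lnn (expn m k) = INR k * lnn m.
Proof. by move=> m0; rewrite /lnn INR_expn ln_pow //; apply: INR_gt0. Qed.

Lemma lnn_leq (m n : nat) : (0 < m)%nat -> (m <= n)%nat -> lnn m <= lnn n.
Proof. by move=> m0 mn; apply: ln_le; [apply: INR_gt0 | apply: INR_leq]. Qed.

Lemma ln_le_sub1 x : 0 < x -> ln x <= x - 1.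
Proof. by move=> x0; have := exp_ineq1_le (ln x); rewrite exp_ln //; lra. Qed.

(** Both bounds are [ln y <= y - 1], at [y = (m + 1) / m] and at its inverse; they are the induction
    steps of [lnn_fact_bounds]. *)
Lemma lnn_succ_bounds (m : nat) : (0 < m)%nat ->
  INR m * (lnn m.+1 - lnn m) <= 1 <= (INR m + 1) * (lnn m.+1 - lnn m).
Proof.
move=> m0; have M0 := INR_gt0 m0; rewrite /lnn S_INR; move: (INR m) M0 => M M0.
have ln_quot a b : 0 < a -> 0 < b -> ln a - ln b <= a / b - 1.
  move=> a0 b0; have q0 : 0 < a / b by apply: Rdiv_lt_0_compat.
  have -> : ln a = ln (a / b) + ln b by rewrite -ln_mult //; congr ln; field; lra.
  by have := ln_le_sub1 q0; lra.
have M1 : 0 < M + 1 by lra.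
have H1 := ln_quot _ _ M1 M0; have H2 := ln_quot _ _ M0 M1; split.
  have E : M * ((M + 1) / M - 1) = 1 by field; lra.
  rewrite -[X in _ <= X]E.
  by apply: Rmult_le_compat_l; lra.
have E : (M + 1) * (1 - M / (M + 1)) = 1 by field; lra.
rewrite -[X in X <= _]E.
by apply: Rmult_le_compat_l; lra.
Qed.

Lemma lnn_fact_bounds (m : nat) : (0 < m)%nat ->
  INR m * lnn m - INR m <= lnn (factorial m) <= INR m * lnn m - INR m + lnn m + 1.
Proof.
elim: m => // -[_ _|m IH _].
  by rewrite /lnn /= ln_1; lra.
have := IH isT; have := lnn_succ_bounds (ltn0Sn m).
rewrite (factS m.+1) lnn_muln ?fact_gt0 // [INR m.+2]S_INR.
lra.
Qed.

(** Since [(1 + y / k) ^ k <= exp y], a numerical bound on a logarithm reduces to rational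
    arithmetic. *)
Lemma ln_le_exponent x y k : 0 < x -> 0 < y -> x <= (1 + y / INR k) ^ k -> (0 < k)%nat ->
  ln x <= y.
Proof.
move=> x0 y0 xy k0; have K0 := INR_gt0 k0.
have yk : 0 < y / INR k by apply: Rdiv_lt_0_compat.
apply: Rle_trans (ln_le x0 xy) _; rewrite ln_pow; last lra.
have -> : y = INR k * (1 + y / INR k - 1) by field; lra.
apply: Rmult_le_compat_l; first lra.
have -> : 1 + (INR k * (1 + y / INR k - 1)) / INR k = 1 + y / INR k by field; lra.
by apply: ln_le_sub1; lra.
Qed.

Lemma ln_5_le : ln 5 <= 17/10.
Proof. by apply: (@ln_le_exponent _ _ 16) => //=; lra. Qed.

Lemma ln_72_le : ln 72 <= 44/10.
Proof. by apply: (@ln_le_exponent _ _ 128) => //=; lra. Qed.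

Lemma ln_35_ge : 1 <= ln (7/2).
Proof.
by rewrite -[1]ln_exp; apply: ln_le; [apply: exp_pos | have := exp_le_3; lra].
Qed.

(** With [u = ln p] and [l = ln n], logarithms give, to leading order,
    [(7/2) n (u + 4 l) <= 30 n l + 6 k u]. As [6 l <= u], [k] is about [5 n / 36] or more; the
    constant 15 leaves room for the lower-order terms. *)
Lemma count_lower_bound (p n g k : nat) :
  100 <= lnn p -> (0 < p)%nat -> (74 < n)%nat -> (expn n 6 <= p)%nat -> (7 * n <= 2 * g)%nat ->
  (expn p g * expn (factorial g) 4 <=
     expn (factorial (5 * n)) 6 * expn (expn 72 2 * (p * expn n 6)) (3 * k))%nat ->
  INR n + 1 <= 15 * INR k.
Proof.
move=> u100 p0 n75 n6 gn H.
have n0 : (0 < n)%nat by case: (n) n75.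
have g0 : (0 < g)%nat by case: (g) gn => //; case: (n) n0.
have N75 : 75 <= INR n by have := INR_leq n75; rewrite /=; lra.
have e0 a b : (0 < a)%nat -> (0 < expn a b)%nat by move=> a0; rewrite expn_gt0 a0.
have f0 := fact_gt0.
have B0 : (0 < p * expn n 6)%nat by rewrite (muln_gt0 p) p0 e0.
have C0 : (0 < expn 72 2 * (p * expn n 6))%nat by rewrite (muln_gt0 (expn 72 2)) B0.
have E1 : lnn (expn p g * expn (factorial g) 4)%nat = INR g * lnn p + INR 4 * lnn (factorial g).
  by rewrite (lnn_muln (e0 _ _ p0) (e0 _ _ (f0 g))) (lnn_expn _ p0) (lnn_expn _ (f0 g)).
have E2 : lnn (expn (factorial (5 * n)) 6 * expn (expn 72 2 * (p * expn n 6)) (3 * k))%nat =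
    INR 6 * lnn (factorial (5 * n)) + INR (3 * k)%nat * (INR 2 * lnn 72 + (lnn p + INR 6 * lnn n)).
  rewrite (lnn_muln (e0 _ _ (f0 _)) (e0 _ _ C0)) (lnn_expn _ (f0 _)) (lnn_expn _ C0).
  by rewrite (lnn_muln (e0 72%nat 2%nat isT) B0) (lnn_muln p0 (e0 _ _ n0)) (lnn_expn _ n0) (@lnn_expn 72).
have P0 : (0 < expn p g * expn (factorial g) 4)%nat by rewrite (muln_gt0 (expn p g)) !e0.
have := lnn_leq P0 H; rewrite {H} E1 E2.
have m0 : (0 < 5 * n)%nat by rewrite muln_gt0.
have [_ F5] := lnn_fact_bounds m0; have [Fg _] := lnn_fact_bounds g0.
move: F5; rewrite lnn_muln // => F5.
have E5 : INR 5 = 5 by rewrite /=; lra.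
have E72 : INR 72 = 72 by rewrite /=; lra.
have L5 : lnn 5 <= 17/10 by rewrite /lnn E5; exact: ln_5_le.
have L72 : lnn 72 <= 44/10 by rewrite /lnn E72; exact: ln_72_le.
have N6 : 6 * lnn n <= lnn p.
  have := lnn_leq (e0 _ 6%nat n0) n6; rewrite lnn_expn //; rewrite /=; lra.
have G : 7/2 * INR n <= INR g.
  have := INR_leq gn; rewrite !INR_muln /=; lra.
(* Because [7/2] exceeds [e], this absorbs the [- g] of the factorial bound, so that
   [ln (g!) >= g ln n]. *)
have LG : lnn n + 1 <= lnn g.
  apply: Rle_trans (ln_le _ G); last lra.
  by rewrite ln_mult; [have := ln_35_ge; rewrite /lnn; lra | lra | lra].
have L0 : 0 <= lnn n.
  by have := @lnn_leq 1 n isT n0; rewrite /lnn /= ln_1.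
rewrite (INR_muln 5) in F5; rewrite (INR_muln 3).
have -> : INR 6 = 6 by rewrite /=; lra.
have -> : INR 4 = 4 by rewrite /=; lra.
have -> : INR 2 = 2 by rewrite /=; lra.
have -> : INR 3 = 3 by rewrite /=; lra.
rewrite E5 in F5.
have K0 : 0 <= INR k := pos_INR k.
move: (lnn p) (lnn n) (lnn g) (lnn (factorial g)) (lnn (factorial (5 * n)))
  (lnn 5) (lnn 72) (INR n) (INR g) (INR k) u100 N75 F5 Fg L5 L72 N6 G LG L0 K0.
clear => u l lg fg f5 l5 l72 N G K u100 N75 F5 Fg L5 L72 N6 GN LG L0 K0 H.
have {}Fg : G * l <= fg.
  apply: Rle_trans Fg; have : G * (l + 1) <= G * lg by apply: Rmult_le_compat_l; lra.
  lra.
have {}F5 : f5 <= 5 * N * (l + 7/10) + l + 27/10.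
  apply: Rle_trans F5 _.
  have : 5 * N * (l5 + l) <= 5 * N * (17/10 + l) by apply: Rmult_le_compat_l; lra.
  lra.
have Glow : 7/2 * N * (u + 4 * l) <= G * (u + 4 * l) by apply: Rmult_le_compat_r; lra.
have Kup : 3 * K * (2 * l72 + (u + 6 * l)) <= 3 * K * (2 * u + 88/10).
  by apply: Rmult_le_compat_l; lra.
have Nl : N * (6 * l) <= N * u by apply: Rmult_le_compat_l; lra.
apply: Rnot_lt_le => KN.
have KN' : 3 * K * (2 * u + 88/10) <= (N + 1) / 5 * (2 * u + 88/10).
  by apply: Rmult_le_compat_r; lra.
(* This bounds the product [N u] below by terms linear in [N] and [u], after which the contradiction
   is linear. *)
have : 0 <= (N - 75) * (u - 100) by apply: Rmult_le_pos; lra.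
lra.
Qed.

(** [P] is a proposition without a decision procedure, so membership is settled by excluded
    middle. *)
Lemma bounded_seq_exists (P : nat -> Prop) (b : nat) :
  (forall q, P q -> (q < b)%nat) ->
  exists l : seq nat, uniq l /\ forall q, q \in l <-> P q.
Proof.
move=> Pb; have [l [lu lP]] : exists l : seq nat,
    uniq l /\ forall q, q \in l <-> (q < b)%nat /\ P q.
  elim: b {Pb} => [|b [l [lu lP]]]; first by exists [::]; split=> // q; split=> // -[].
  case: (classic (P b)) => Pb; last first.
    exists l; split=> // q; rewrite lP ltnS; split=> -[qb Pq]; split=> //; first exact: ltnW.
    by rewrite ltn_neqAle qb andbT; apply/eqP => E; rewrite E in Pq.
  exists (b :: l); split.
    by rewrite /= lu andbT; apply/negP => /lP[]; rewrite ltnn.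
  move=> q; rewrite inE ltnS leq_eqVlt; split=> [/orP[/eqP ->|/lP[qb Pq]]|[/orP[qb|qb] Pq]].
  - by rewrite eqxx.
  - by rewrite qb orbT.
  - by rewrite qb.
  by apply/orP; right; apply/lP.
by exists l; split=> // q; rewrite lP; split=> [[]|Pq] //; split=> //; apply: Pb.
Qed.

Lemma nat_floor_exists x : 0 <= x -> exists n : nat, INR n <= x < INR n + 1.
Proof.
move=> x0; have [H1 H2] := base_Int_part x.
have z0 : (0 <= Int_part x)%Z.
  have : (-1 < Int_part x)%Z by apply: lt_IZR; lra.
  by move/Z.le_succ_l.
have [n En] := IZN _ z0; exists n; rewrite INR_IZR_INZ -En; lra.
Qed.

Theorem theorem2 (eps : R) (p : nat) :
  0 < eps <= 1/2 ->
  prime p ->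
  Rpower (INR p) (eps / 3) >= 75 ->
  INR p >= exp 100 ->
  exists l : seq nat,
    uniq l /\
    (forall q : nat, q \in l <->
       (prime q /\ Rpower (INR p) (eps / 3) < INR q /\
        INR q <= 72 * Rpower (INR p) (1/2 + eps) /\ cubic_residue p q)) /\
    INR (size l) >= 1/15 * Rpower (INR p) (eps / 3).
Proof.
move=> [eps0 eps1] pp X75 pbig.
have p0 := prime_gt0 pp; have P0 := INR_gt0 p0.
have u100 : 100 <= lnn p.
  by rewrite -[100]ln_exp; apply: ln_le; [exact: exp_pos | lra].
set X := Rpower _ _ in X75 *; set Y := 72 * _.
have LX : ln X = eps / 3 * lnn p by rewrite /X ln_Rpower.
have X0 : 0 < X by lra.
have Y0 : 0 < Y by apply: Rmult_lt_0_compat; [lra | exact: exp_pos].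
have LY : ln Y = ln 72 + (1/2 + eps) * lnn p.
  by rewrite /Y ln_mult ?ln_Rpower //; [lra | exact: exp_pos].
have [n [nX Xn]] := @nat_floor_exists X (Rlt_le _ _ X0).
have n75 : (74 < n)%nat.
  rewrite ltnNge; apply/negP => /INR_leq.
  have -> : INR 74 = 74 by rewrite /=; lra.
  lra.
have n0 : (0 < n)%nat by case: (n) n75.
have N0 := INR_gt0 n0.
have LN : lnn n <= eps / 3 * lnn p by rewrite -LX; exact: ln_le.
(* This is where [eps <= 1/2] enters: [n <= p ^ (eps / 3) <= p ^ (1/6)]. *)
have n6 : (expn n 6 <= p)%nat.
  apply: leq_INR; rewrite -[INR p]exp_ln // -[INR (expn n 6)]exp_ln; last first.
    by apply: INR_gt0; rewrite expn_gt0 n0.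
  have : ln (INR (expn n 6)) <= ln (INR p).
    have -> : ln (INR (expn n 6)) = 6 * lnn n.
      by rewrite -/(lnn (expn n 6)) lnn_expn //=; lra.
    have : eps * lnn p <= 1/2 * lnn p by apply: Rmult_le_compat_r; lra.
    rewrite -/(lnn p); lra.
  by case=> [lt|->]; [left; exact: exp_increasing | right].
have [S SP] := exists_residue_sequence pp n75 n6.
have [|Qs [g [Qu Qp gn H]]] := residue_sequence_count pp _ SP.
  exact: leq_trans n75.
have K := count_lower_bound u100 p0 n75 n6 gn H.
have [l [lu lP]] : exists l : seq nat, uniq l /\ forall q : nat, q \in l <->
       (prime q /\ X < INR q /\ INR q <= Y /\ cubic_residue p q).
  have [b [_ bY]] := @nat_floor_exists Y (Rlt_le _ _ Y0).
  apply: (@bounded_seq_exists _ b.+1) => q [_ [_ [qY _]]].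
  rewrite ltnNge; apply/negP => /INR_leq; rewrite S_INR; lra.
exists l; split=> //; split=> //.
(* The count is at least [(n + 1) / 15], and [n + 1] exceeds [X], so rounding down costs nothing. *)
suff sub : {subset Qs <= l}.
  have KK : INR (size Qs) <= INR (size l) := INR_leq (uniq_leq_size Qu sub).
  lra.
move=> q /Qp[pq nq cq qB]; apply/lP; do 2!split=> //.
  by have := INR_leq nq; rewrite S_INR; lra.
split=> //.
have q0 := prime_gt0 pq; have Q0 := INR_gt0 q0.
have e0 a b : (0 < a)%nat -> (0 < expn a b)%nat by move=> a0; rewrite expn_gt0 a0.
have B0 : (0 < p * expn n 6)%nat by rewrite (muln_gt0 p) p0 e0.
(* The upper bound follows from [q ^ 2 <= 72 ^ 2 p n ^ 6] and [n ^ 6 <= p ^ (2 eps)], compared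
   through logarithms. *)
have := lnn_leq (e0 _ 2%nat q0) qB.
rewrite (lnn_muln (e0 72%nat 2%nat isT) B0) (lnn_muln p0 (e0 _ _ n0)).
rewrite (lnn_expn _ n0) (@lnn_expn 72) // (lnn_expn _ q0).
have -> : INR 6 = 6 by rewrite /=; lra.
have -> : INR 2 = 2 by rewrite /=; lra.
have -> : lnn 72 = ln 72 by rewrite /lnn; congr ln; rewrite /=; lra.
move=> Hq.
have : ln (INR q) <= ln Y by rewrite LY -/(lnn q); lra.
case=> [lt|E]; first by left; exact: ln_lt_inv.
by right; apply: ln_inv.
Qed.
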